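(* Let $G$ be a planar graph. Then \[ 2n^+(G) \le n^-(G)\,(n^-(G)+1). \]
   Context: Graphs are finite and simple. For a graph $G$ with adjacency matrix $A(G)$, $n^+(G)$ and $n^-(G)$ denote the number of positive and negative eigenvalues of $A(G)$, respectively, counted with multiplicity. *)

(* Defs.v *)
From mathcomp Require Import all_boot all_order all_algebra.
From mathcomp Require Import polyrcf.
From mathcomp Require Import classical_sets functions reals topology normedtype.

Set Implicit Arguments.
Unset Strict Implicit.
Unset Printing Implicit Defensive.

Import Order.TTheory GRing.Theory Num.Theory.
Import numFieldNormedType.Exports.

Local Open Scope classical_set_scope.
Local Open Scope ring_scope.

Definition simple_graph (V : finType) (e : rel V) : Prop :=
  symmetric e /\ irreflexive e.

Definition adjacency (R : realType) (V : finType) (e : rel V) : 'M[R]_#|V| :=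
  \matrix_(i, j) (e (enum_val i) (enum_val j))%:R.

(* [rootsR p] lists the distinct roots of [p] in [R], and [mup x p] is the
   multiplicity of [x] as a root of [p].  A real symmetric matrix has only
   real eigenvalues, and their algebraic and geometric multiplicities agree. *)
Definition npos (R : realType) (V : finType) (e : rel V) : nat :=
  let p := char_poly (adjacency R e) in
  (\sum_(x <- rootsR p | (0 < x)%R) mup x p)%N.

Definition nneg (R : realType) (V : finType) (e : rel V) : nat :=
  let p := char_poly (adjacency R e) in
  (\sum_(x <- rootsR p | (x < 0)%R) mup x p)%N.

Definition simple_arc (R : realType) (A : set (R * R)) (a b : R * R) : Prop :=
  exists f : R -> R * R,
    [/\ {within `[0, 1], continuous f},
        set_inj `[0, 1] f,
        f 0 = a, f 1 = b & f @` `[0, 1] = A].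

(* A drawing sends vertices to distinct points of the plane and each edge to an
   arc joining its ends; an arc contains no vertex other than its ends, and two
   different edges meet only in vertices.  The unordered edge uv is indexed by
   both (u, v) and (v, u), whence the symmetry condition on [arc]. *)
Definition plane_drawing (R : realType) (V : finType) (e : rel V)
    (pt : V -> R * R) (arc : V -> V -> set (R * R)) : Prop :=
  [/\ injective pt,
      forall u v, e u v -> arc u v = arc v u,
      forall u v, e u v -> simple_arc (arc u v) (pt u) (pt v),
      forall u v w, e u v -> arc u v (pt w) -> w = u \/ w = v &
      forall u v x y, e u v -> e x y -> (x, y) <> (u, v) -> (x, y) <> (v, u) ->
        arc u v `&` arc x y `<=` range pt].

Definition planar (R : realType) (V : finType) (e : rel V) : Prop :=
  exists pt arc, @plane_drawing R V e pt arc.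

(* Main.v *)
(* Planarity is used only through the absence of a K5 minor.  Rounding a plane
   drawing to a fine grid turns its edges into polylines, in which independent
   edges stay far apart; this survives the contraction of an edge, and K5 has no
   such drawing, by counting crossings modulo 2.  By Mader's theorem, a graph
   without K5 minor has at most 3n - 6 edges.

   The numbers n+ and n- are the maximal dimensions of subspaces on which the
   adjacency form is positive, respectively negative, definite.  Deleting the
   neighbours of a non-isolated vertex v lowers n- by at least 1 and n+ by at
   most deg v.  A minimal counterexample to "n- <= k implies n+ <= m" has exactly
   m + 1 + k vertices, and all its degrees exceed m - m', where m' is the bound
   for k - 1.  The bounds m = 0, 1, 3, 5 hold for k = 0, 1, 2, 3, and m = k(k+1)/2
   for k >= 4, where all degrees would be at least 6, contrary to Mader's theorem.
   The case k = 3 is the hard one: a counterexample has 9 vertices and one of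
   degree 3, whose five non-neighbours form a pentagon; this leaves two graphs,
   which have K5 minors. *)

Require Import Defs.
From mathcomp Require Import all_boot all_order all_algebra reals.
From mathcomp Require Import zify ring lra polyrcf complex.
From mathcomp Require Import boolp.
From Stdlib Require Import Btauto.

Set Implicit Arguments.
Unset Strict Implicit.
Unset Printing Implicit Defensive.

Import Order.TTheory GRing.Theory Num.Theory.

(** * K5 minors and Mader's bound *)

(** Every structural restriction on a critical set comes from exhibiting vectors. Independent,
    pairwise orthogonal vectors of nonpositive square span a subspace that meets a positive definite
    one only in 0; so on a critical set of m + 1 + k vertices there are at most k of them. Cliques,
    large independent sets, twins, the bowtie and bad pentagons are all excluded by writing down k +
    1 such vectors. The value 5 at k = 3, one less than the triangular number 6, is what starts the
    general step: to reach degree 6 the bound must grow by at least 5, and from 6 to 10 it would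
    grow only by 4. Arcs are merely continuous, so faces and the Jordan curve theorem are avoided.
    Only the distance between independent edges is kept of a drawing. After a contraction several
    edges at the merged vertex may share a polyline; this is harmless, because the parity argument
    for K5 looks at independent edges only. *)

Definition contract (T : eqType) (u v : T) (e : rel T) : rel T := fun x y =>
  [&& x != v, y != v, x != y
    & [|| e x y, (x == u) && e v y | (y == u) && e x v]].

(** Deletions need no constructor: the base case ignores all other vertices and edges. Contraction
    merges [v] into [u] and leaves [v] isolated, so that the vertex type stays the same. *)
Inductive has_K5_minor (T : eqType) (e : rel T) : Prop :=
| K5_minor_base (s : seq T) of
    uniq s & size s = 5 & {in s &, forall x y, x != y -> e x y}
| K5_minor_contract u v of e u v & has_K5_minor (contract u v e).

(** Contraction is monotone in the edge relation, so the same contractions can be replayed in the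
    larger graph. *)
Lemma has_K5_minor_inj (S T : eqType) (f : S -> T) (g : rel S) (e : rel T) :
  injective f -> (forall x y, g x y -> e (f x) (f y)) ->
  has_K5_minor g -> has_K5_minor e.
Proof.
move=> f_inj ge gK; elim: gK e ge => {g} [g s s_uniq ss sg|g u v guv _ IH] e ge.
  apply: (@K5_minor_base _ _ (map f s)); rewrite ?map_inj_uniq ?size_map //.
  move=> _ _ /mapP[x xs ->] /mapP[y ys ->] nxy; apply/ge/sg => //.
  by apply: contra nxy => /eqP ->.
apply: (@K5_minor_contract _ _ (f u) (f v)); first exact: ge.
apply: IH => x y /and4P[xv yv xy H]; rewrite /contract !(inj_eq f_inj) xv yv xy /=.
by case/or3P: H => [/ge->|/andP[-> /ge->]|/andP[-> /ge->]]; rewrite ?orbT.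
Qed.

Lemma has_K5_minor_sub (T : eqType) (g e : rel T) :
  subrel g e -> has_K5_minor g -> has_K5_minor e.
Proof. by move=> ge; apply: (@has_K5_minor_inj _ _ id). Qed.

Lemma contract_sym (T : eqType) (e : rel T) u v :
  symmetric e -> symmetric (contract u v e).
Proof.
move=> e_sym x y; rewrite /contract (eq_sym y x) (e_sym y x) (e_sym v x) (e_sym y v).
rewrite andbCA; congr [&& _, _, _ & _]; congr (_ || _).
by rewrite orbC.
Qed.

Lemma contract_irr (T : eqType) (e : rel T) u v : irreflexive (contract u v e).
Proof. by move=> x; rewrite /contract eqxx !andbF. Qed.

Definition nbrs (T : finType) (e : rel T) x : {set T} := [set y | e x y].
Definition arcs (T : finType) (e : rel T) : nat := \sum_x #|nbrs e x|.

Lemma mem_nbrs (T : finType) (e : rel T) x y : (y \in nbrs e x) = e x y.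
Proof. by rewrite inE. Qed.

(** [arcs] counts each edge twice. Contracting [uv] loses this edge and identifies [xu] with [xv]
    for each common neighbour [x]. *)
Lemma arcs_contract (T : finType) (e : rel T) (e_sym : symmetric e)
    (e_irr : irreflexive e) u v (uv : e u v) :
  arcs e = arcs (contract u v e) + 2 + 2 * #|nbrs e u :&: nbrs e v|.
Proof.
have nuv : v != u by apply: contraL uv => /eqP ->; rewrite e_irr.
have vu : e v u by rewrite e_sym.
set C := nbrs e u :&: nbrs e v.
have Nv : nbrs (contract u v e) v = set0.
  by apply/setP => y; rewrite !inE /contract eqxx.
have Nu : nbrs (contract u v e) u = (nbrs e u :|: nbrs e v) :\ u :\ v.
  apply/setP => y; rewrite !inE /contract eqxx (eq_sym u v) nuv /= (eq_sym u y).
  by case: (eqVneq y u) => // /= yu; rewrite orbF.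
have cNu : #|nbrs (contract u v e) u| + #|C| + 2 = #|nbrs e u| + #|nbrs e v|.
  rewrite -[RHS]cardsUI -/C Nu (cardsD1 u (_ :|: _)) (cardsD1 v (_ :\ u)).
  by rewrite !inE uv vu nuv !orbT /=; lia.
have Nx x : x != u -> x != v ->
    #|nbrs e x| = #|nbrs (contract u v e) x| + (x \in C).
  move=> xu xv; case: (boolP (e x v)) => exv; last first.
    have -> : x \in C = false by rewrite !inE (e_sym v) (negPf exv) andbF.
    rewrite addn0; apply: eq_card => y; rewrite !inE /contract xv /= (negPf xu) /=.
    rewrite (negPf exv) andbF orbF; case: (eqVneq y v) => [->|] /=.
      by rewrite (negPf exv).
    by case: (eqVneq x y) => // ->; rewrite e_irr.
  rewrite !inE (e_sym v) exv andbT e_sym.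
  have -> : nbrs (contract u v e) x = u |: (nbrs e x :\ v).
    apply/setP => y; rewrite !inE /contract xv exv (negPf xu) /= andbT.
    case: (eqVneq y v) => [-> /=|yv /=]; first by rewrite (negPf nuv).
    case: (eqVneq x y) => [<-|xy /=]; first by rewrite e_irr (negPf xu).
    by rewrite orbC.
  rewrite cardsU1 (cardsD1 v (nbrs e x)) !inE exv (eq_sym u v) nuv /=.
  by case: (e x u) => /=; lia.
rewrite /arcs (bigD1 v) //= (bigD1 u) ?(eq_sym u) //=.
rewrite [in RHS](bigD1 v) //= [in RHS](bigD1 u) ?(eq_sym u) //= Nv cards0.
have -> : \sum_(i | (i != v) && (i != u)) #|nbrs e i| =
  \sum_(i | (i != v) && (i != u)) #|nbrs (contract u v e) i| + #|C|.
  rewrite -sum1_card (big_mkcond (mem C)) /=.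
  rewrite [X in _ + X](bigD1 v) //= [X in _ + (_ + X)](bigD1 u) ?(eq_sym u) //=.
  have -> : (v \in C) = false by rewrite !inE e_irr andbF.
  have -> : (u \in C) = false by rewrite !inE e_irr.
  rewrite !add0n -big_split /=; apply: eq_bigr => x /andP[xv xu].
  by rewrite Nx //; case: ifP.
lia.
Qed.

Lemma clique_K5_minor (T : finType) (e : rel T) (S : {set T}) :
  4 < #|S| -> {in S &, forall x y, x != y -> e x y} -> has_K5_minor e.
Proof.
move=> S5 Se; apply: (@K5_minor_base _ _ (take 5 (enum S))).
- by rewrite take_uniq ?enum_uniq.
- by rewrite size_takel // -cardE.
by move=> x y /mem_take xS /mem_take yS; apply: Se; rewrite -mem_enum.
Qed.

(** In the link of [v] each vertex misses at most one other, so the non-edges form a matching on at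
    most 5 vertices. Dropping an end of a single non-edge leaves a K4, coned by [v]; if there are
    two non-edges, contracting an edge between them repairs both. *)
Lemma dense_link_K5_minor (T : finType) (e : rel T) (e_sym : symmetric e)
    (e_irr : irreflexive e) v :
  0 < #|nbrs e v| <= 5 ->
  {in nbrs e v, forall u, 2 < #|nbrs e u :&: nbrs e v|} -> has_K5_minor e.
Proof.
set N := nbrs e v => /andP[N0 N5] common.
have nn x y z : x \in N -> y \in N -> z \in N -> y != x -> z != x ->
    ~~ e x y -> ~~ e x z -> y = z.
  move=> xN yN zN yx zx exy exz; apply/eqP; apply: contraT => yz.
  have sub : [set x; y; z] :|: (nbrs e x :&: N) \subset N.
    rewrite subUset subsetIr andbT; apply/subsetP => t.
    by rewrite in_setU in_set2 in_set1 => /orP[/orP[]|] /eqP ->.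
  have dis : [set x; y; z] :&: (nbrs e x :&: N) = set0.
    apply/setP => t; rewrite in_setI in_setU in_set2 in_set1 in_set0 in_setI inE.
    apply/negP => /andP[/orP[/orP[]|] /eqP -> /andP[]] //.
    - by rewrite e_irr.
    - by rewrite (negPf exy).
    - by rewrite (negPf exz).
  have := subset_leq_card sub; have := cardsUI [set x; y; z] (nbrs e x :&: N).
  rewrite dis cards0 [in X in _ = X]setUC cardsU1 cards2 !inE.
  have := common _ xN; rewrite (negPf zx) (eq_sym z) (negPf yz) (eq_sym x) yx /=.
  by lia.
have vN : v \notin N by rewrite mem_nbrs e_irr.
have cone b : #|N :\ b| = 4 -> {in N :\ b &, forall x y, x != y -> e x y} ->
    has_K5_minor e.
  move=> Nb clq; apply: (@clique_K5_minor _ _ (v |: (N :\ b))).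
    by rewrite cardsU1 Nb !inE e_irr andbF.
  move=> x y /setU1P[->|xN] /setU1P[->|yN] xy; first by rewrite eqxx in xy.
  - by move: yN; rewrite !inE => /andP[].
  - by move: xN; rewrite !inE e_sym => /andP[].
  - exact: clq.
have N4 : 3 < #|N|.
  have [u uN] : exists u, u \in N by apply/set0Pn; rewrite -card_gt0.
  have := common u uN; have : #|(nbrs e u :&: N)| <= #|N :\ u|.
    apply/subset_leq_card/subsetP => t; rewrite in_setI in_setD1 mem_nbrs.
    by case/andP=> ut ->; rewrite andbT; apply: contraTneq ut => ->; rewrite e_irr.
  by rewrite (cardsD1 u N) uN; lia.
have [/existsP[b /existsP[b' /and4P[bN b'N bb' ebb']]]|clq] :=
  boolP [exists b, exists b', [&& b \in N, b' \in N, b != b' & ~~ e b b']]; last first.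
  have clqN : {in N &, forall x y, x != y -> e x y}.
    move=> x y xN yN xy; apply: contraNT clq => exy.
    by apply/existsP; exists x; apply/existsP; exists y; rewrite xN yN xy.
  move: N4; rewrite leq_eqVlt => /orP[/eqP N4|N4]; last exact: (clique_K5_minor N4).
  (* As [v] is not in [N], [cone] applies here with nothing removed. *)
  have D : N :\ v = N.
    apply/setP => x; rewrite in_setD1.
    by case: eqVneq => // ->; rewrite (negPf vN).
  by apply: (@cone v); rewrite D.
have cN : #|N| = 5.
  have sub : [set b; b'] :|: (nbrs e b :&: N) \subset N.
    rewrite subUset subsetIr andbT; apply/subsetP => t.
    by rewrite in_set2 => /orP[] /eqP ->.
  have dis : [set b; b'] :&: (nbrs e b :&: N) = set0.
    apply/setP => t; rewrite in_setI in_set2 in_set0 in_setI inE.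
    apply/negP => /andP[/orP[] /eqP -> /andP[]] //.
    - by rewrite e_irr.
    - by rewrite (negPf ebb').
  have := subset_leq_card sub; have := cardsUI [set b; b'] (nbrs e b :&: N).
  by rewrite dis cards0 cards2 bb' /=; have := common _ bN; lia.
have cNb : #|N :\ b| = 4 by move: (cardsD1 b N); rewrite cN bN => -[].
have [/existsP[c /existsP[c' /and4P[]]]|clq] :=
  boolP [exists c, exists c', [&& c \in N :\ b, c' \in N :\ b, c != c' & ~~ e c c']];
    last first.
  apply: (cone b cNb) => x y xN yN xy; apply: contraNT clq => exy.
  by apply/existsP; exists x; apply/existsP; exists y; rewrite xN yN xy.
rewrite !in_setD1 => /andP[cb cN'] /andP[c'b c'N] cc' ecc'.
have cb' : c != b'.
  apply: contraNneq c'b => E; move: cc' ecc'; rewrite E => b'c' eb'c'.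
  by apply/eqP; rewrite (nn b' c' b) // 1?eq_sym // e_sym.
have c'b' : c' != b'.
  apply: contraNneq cb => E; move: cc' ecc'; rewrite E => b'c' eb'c'.
  by apply/eqP; rewrite (nn b' c b) // 1?eq_sym // e_sym.
have ebc : e b c by apply: contraT => ebc; rewrite (nn b c b') ?eqxx // in cb'; rewrite eq_sym.
have ebc' : e b c' by apply: contraT => ebc'; rewrite (nn b c' b') ?eqxx // in c'b'; rewrite eq_sym.
have [a Na] : exists a, N :\ b :\ b' :\ c :\ c' = [set a].
  apply/cards1P; have := cNb.
  have b'1 : b' \in N :\ b by rewrite in_setD1 eq_sym bb' b'N.
  have c1 : c \in N :\ b :\ b' by rewrite !in_setD1 cb cb' cN'.
  have c'1 : c' \in N :\ b :\ b' :\ c by rewrite !in_setD1 c'b c'b' eq_sym cc' c'N.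
  rewrite (cardsD1 b' (N :\ b)) b'1 (cardsD1 c (N :\ b :\ b')) c1.
  by rewrite (cardsD1 c' (_ :\ c)) c'1 /= !add1n => -[->].
apply: (@K5_minor_contract _ _ c b); first by rewrite e_sym.
apply: (@clique_K5_minor _ _ (v |: (N :\ b))).
  by rewrite cardsU1 cNb !inE e_irr andbF.
have bv : v != b by apply: contraNneq vN => ->.
move=> x y /setU1P[->|xNb] /setU1P[->|yNb] xy; first by rewrite eqxx in xy.
- move: yNb; rewrite in_setD1 mem_nbrs => /andP[yb vy].
  by rewrite /contract bv yb xy vy.
- move: xNb; rewrite in_setD1 mem_nbrs => /andP[xb vx].
  by rewrite /contract bv xb xy e_sym vx.
move: xNb yNb; rewrite !in_setD1 => /andP[xb xN] /andP[yb yN].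
rewrite /contract xb yb xy /=.
case: (boolP (e x y)) => //= exy; rewrite !(e_sym _ b).
have exy' : ~~ e y x by rewrite e_sym.
have yx : y != x by rewrite eq_sym.
have c'c : c' != c by rewrite eq_sym.
have ec'c : ~~ e c' c by rewrite e_sym.
have [xc|xc] := eqVneq x c.
  by rewrite (nn x y c') ?xc //= ?ebc' // -xc.
have [yc|yc] /= := eqVneq y c.
  by rewrite (nn y x c') ?yc //= ?ebc' // -yc.
have xc' : x != c'.
  by apply: contraNneq yc => E; apply/eqP; rewrite (nn x y c) ?E // -E.
have yc' : y != c'.
  by apply: contraNneq xc => E; apply/eqP; rewrite (nn y x c) ?E // -E.
have b'b : b != b' by [].
have eb'b : ~~ e b' b by rewrite e_sym.
have xb' : x != b'.
  by apply: contraNneq yb => E; apply/eqP; rewrite (nn x y b) ?E // -E.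
have yb' : y != b'.
  by apply: contraNneq xb => E; apply/eqP; rewrite (nn y x b) ?E // -E.
have : x \in [set a] by rewrite -Na !in_setD1 xc' xc xb' xb.
have : y \in [set a] by rewrite -Na !in_setD1 yc' yc yb' yb.
by rewrite !in_set1 => /eqP ya /eqP xa; rewrite xa ya eqxx in xy.
Qed.

(** The hypothesis says that there are at least 3|W| - 5 edges. Surplus edges are deleted until
    equality, which forces a vertex [v] of degree at most 5. Contracting an edge at [v] whose ends
    have at most two common neighbours costs one vertex and at most 3 edges, which preserves the
    hypothesis; if there is none, the link of [v] is dense. [W] carries the vertex count because
    contracted vertices remain in the type. *)
Theorem mader_K5_minor (T : finType) (e : rel T) (W : {set T}) :
  symmetric e -> irreflexive e -> (forall x y, e x y -> x \in W) ->
  2 < #|W| -> 6 * #|W| <= arcs e + 10 -> has_K5_minor e.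
Proof.
have [n] := ubnP (arcs e + #|W|); elim: n e W => // n IH e W ltn e_sym e_irr eW W3 le.
have arcsW (f : rel T) : (forall x y, f x y -> x \in W) -> arcs f = \sum_(x in W) #|nbrs f x|.
  move=> fW; rewrite /arcs [RHS]big_mkcond; apply: eq_bigr => x _.
  case: ifP => // xW; apply/eqP; rewrite cards_eq0; apply/eqP/setP => y.
  by rewrite !inE; apply/negP => /fW; rewrite xW.
have nbrsW x : nbrs e x \subset W :\ x.
  apply/subsetP => y; rewrite !inE e_sym => exy; rewrite (eW _ _ exy) andbT.
  by apply: contraTneq exy => ->; rewrite e_irr.
have [many|few] := leqP (6 * #|W|) (arcs e + 8).
  have [/existsP[u /existsP[v uv]]|noe] := boolP [exists u, exists v, e u v]; last first.
    suff : arcs e = 0 by lia.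
    rewrite /arcs big1 // => x _; apply/eqP; rewrite cards_eq0; apply/eqP/setP => y.
    rewrite !inE; apply: contraNF noe => exy.
    by apply/existsP; exists x; apply/existsP; exists y.
  pose f x y := e x y && ~~ [|| (x == u) && (y == v) | (x == v) && (y == u)].
  have fE : arcs e = arcs f + 2.
    have vu : v != u by apply: contraTneq uv => ->; rewrite e_irr.
    rewrite /arcs (bigD1 u) //= (bigD1 v) //= [in RHS](bigD1 u) //= [in RHS](bigD1 v) //=.
    have -> : \sum_(i | (i != u) && (i != v)) #|nbrs e i| =
              \sum_(i | (i != u) && (i != v)) #|nbrs f i|.
      apply: eq_bigr => x /andP[/negPf xu /negPf xv]; apply: eq_card => y.
      by rewrite !inE /f xu xv /= andbT.
    have -> : nbrs f u = nbrs e u :\ v.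
      by apply/setP => y; rewrite !inE /f eqxx (eq_sym u) (negPf vu) /= orbF andbC.
    have -> : nbrs f v = nbrs e v :\ u.
      by apply/setP => y; rewrite !inE /f eqxx (negPf vu) /= andbC.
    by rewrite (cardsD1 v (nbrs e u)) (cardsD1 u (nbrs e v)) !inE (e_sym v) uv; lia.
  apply: (@has_K5_minor_sub _ f); first by move=> x y /andP[].
  apply: (IH f W) => //; try lia.
  - by move=> x y; rewrite /f e_sym; congr (_ && ~~ _); rewrite orbC andbC [X in _ || X]andbC.
  - by move=> x; rewrite /f e_irr.
  - by move=> x y /andP[/eW].
have [v vW dv] : exists2 v, v \in W & #|nbrs e v| <= 5.
  apply/exists_inP; apply: contraLR few => /exists_inPn deg.
  have : \sum_(x in W) 6 <= \sum_(x in W) #|nbrs e x|.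
    by apply: leq_sum => x /deg; rewrite -ltnNge.
  by rewrite -arcsW // sum_nat_const; lia.
(* Three vertices carry at most 6 arcs, and 18 <= 6 + 10 fails. *)
have W4 : 3 < #|W|.
  have : \sum_(x in W) #|nbrs e x| <= \sum_(x in W) #|W|.-1.
    apply: leq_sum => x xW; apply: leq_trans (subset_leq_card (nbrsW x)) _.
    by rewrite (cardsD1 x W) xW.
  rewrite -arcsW // sum_nat_const ltnNge => le_arcs; apply/negP => le3.
  have E : #|W| = 3 by lia.
  by move: le le_arcs; rewrite E; lia.
have cWv : #|W| = #|W :\ v|.+1 by rewrite (cardsD1 v) vW.
have [Nv0|Nv0] := posnP #|nbrs e v|.
  apply: (IH e (W :\ v)) => //; try lia.
  move=> x y exy; rewrite in_setD1 (eW _ _ exy) andbT.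
  move/eqP: Nv0; rewrite cards_eq0 => /eqP/setP/(_ y); rewrite !inE.
  by apply: contraFneq => <-.
have [/existsP[u /andP[uv cuv]]|all3] :=
    boolP [exists u, (u \in nbrs e v) && (#|nbrs e u :&: nbrs e v| <= 2)].
  have euv : e u v by move: uv; rewrite mem_nbrs e_sym.
  have := arcs_contract e_sym e_irr euv => E.
  apply: (K5_minor_contract euv); apply: (IH _ (W :\ v)); try lia.
  - exact: contract_sym.
  - exact: contract_irr.
  move=> x y /and4P[xv _ _]; rewrite in_setD1 xv /=.
  by case/or3P=> [/eW //|/andP[/eqP-> _]|/andP[_ /eW //]]; apply: eW euv.
apply: (@dense_link_K5_minor _ _ e_sym e_irr v); first by rewrite Nv0.
move=> u uv; rewrite ltnNge; apply: contra all3 => c2.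
by apply/existsP; exists u; rewrite uv.
Qed.

(** * Enumeration of the critical graphs on nine vertices *)

Fixpoint bitstrings k : seq (seq bool) :=
  if k is k'.+1 then
    [seq b :: s | b <- [:: true; false], s <- bitstrings k'] else [:: [::]].

Lemma mem_bitstrings s : s \in bitstrings (size s).
Proof.
elim: s => [//|b s IH].
by apply/allpairsP; exists (b, s); case: b; split.
Qed.

Definition sym_rel (E : seq (nat * nat)) : rel nat :=
  fun i j => ((i, j) \in E) || ((j, i) \in E).

Definition pairs5 := [:: (0, 1); (0, 2); (0, 3); (0, 4);
  (1, 2); (1, 3); (1, 4); (2, 3); (2, 4); (3, 4)].
Definition triples5 := [::
  (0, 1, 2); (0, 1, 3); (0, 1, 4); (0, 2, 3); (0, 2, 4);
  (0, 3, 4); (1, 2, 3); (1, 2, 4); (1, 3, 4); (2, 3, 4)].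
Definition quadruples5 := [:: (0, 1, 2, 3); (0, 1, 2, 4); (0, 1, 3, 4);
  (0, 2, 3, 4); (1, 2, 3, 4)].

Definition C5 := sym_rel [:: (0, 1); (1, 2); (2, 3); (3, 4); (0, 4)].
Definition bowtie := sym_rel [:: (0, 1); (0, 2); (1, 2); (0, 3); (0, 4); (3, 4)].

Definition rel_of_bits (bits : seq bool) : rel nat :=
  fun i j => nth false bits (index (minn i j, maxn i j) pairs5).

(* What n- = 3 forces on the non-neighbours of a vertex.  The nested conditionals
   make [vm_compute] stop at the first failure. *)
Definition link_ok (g : rel nat) : bool :=
  if all (fun '(i, j, k) => [|| g i j, g i k | g j k]) triples5 then
  if all (fun '(i, j, k, l) => ~~ [&& g i j, g i k, g i l, g j k, g j l & g k l])
    quadruples5 then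
  all (fun '(i, j) => if g i j then true else
    all (fun '(x, y) => if x \in [:: i; j] then true else if y \in [:: i; j] then true
      else ~~ ((g i x == g i y) && (g j x == g j y))) pairs5) pairs5
  else false else false.

Definition isomorphic5 (h g : rel nat) (p : seq nat) : bool :=
  all (fun ij => g (nth 0 p ij.1) (nth 0 p ij.2) == h ij.1 ij.2) pairs5.

(** Of all 2^10 graphs on five labelled vertices, the survivors are pentagons and pairs of triangles
    sharing a vertex; [no_bowtie] excludes the latter. *)
Lemma link_classification : all (fun bits => let g := rel_of_bits bits in
  if link_ok g then has (fun p => isomorphic5 C5 g p || isomorphic5 bowtie g p)
    (permutations (iota 0 5)) else true) (bitstrings 10).
Proof. by vm_compute. Qed.

(* [C5_form b c < 0] says that [d^T C^-1 d < 0], where [C] is the adjacency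
   matrix of the pentagon, [C^-1 = C + 1 - J / 2], and [d = b - c]. *)
Definition C5_form (b c : seq bool) : int :=
  let d i := ((nth false b i)%:Z - (nth false c i)%:Z)%R in
  let: (d0, d1, d2, d3, d4) := (d 0, d 1, d 2, d 3, d 4) in
  (4 * (d0 * d1 + d1 * d2 + d2 * d3 + d3 * d4 + d4 * d0) +
   2 * (d0 * d0 + d1 * d1 + d2 * d2 + d3 * d3 + d4 * d4) -
   (d0 + d1 + d2 + d3 + d4) * (d0 + d1 + d2 + d3 + d4))%R.

Definition pentagon_edges := [:: (4, 5); (5, 6); (6, 7); (7, 8); (4, 8)].
Definition spokes := [:: (0, 1); (0, 2); (0, 3)].
Definition edges1 := spokes ++ pentagon_edges ++
  [:: (1, 5); (1, 8); (2, 4); (2, 6); (3, 4); (3, 5); (3, 7)].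
Definition edges2 := spokes ++ pentagon_edges ++
  [:: (1, 4); (1, 6); (1, 7); (2, 5); (2, 7); (2, 8); (3, 6); (3, 8)].

(* Vertex 0 is joined to 1, 2, 3, vertices 4 to 8 form a pentagon, and the rows
   give the adjacencies of 1, 2, 3 to the pentagon. *)
Definition graph9 (rows : seq (seq bool)) : rel nat := fun i j =>
  [|| sym_rel (spokes ++ pentagon_edges) i j,
      [&& 0 < i < 4, 3 < j & nth false (nth [::] rows i.-1) (j - 4)] |
      [&& 0 < j < 4, 3 < i & nth false (nth [::] rows j.-1) (i - 4)]].

(** The symmetries of the fixed part: permutations of the neighbours of 0, times the dihedral group
    of the pentagon. *)
Definition relabellings := [seq 0 :: p ++ q | p <- permutations [:: 1; 2; 3],
  q <- [seq rot i q | q <- [:: [:: 4; 5; 6; 7; 8]; [:: 8; 7; 6; 5; 4]], i <- iota 0 5]].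

Definition contains (E : seq (nat * nat)) (g : rel nat) (p : seq nat) : bool :=
  all (fun ij => g (nth 0 p ij.1) (nth 0 p ij.2)) E.

(** Containment instead of isomorphism suffices, since having a K5 minor is monotone; for the same
    reason [graph9] may omit edges among 1, 2 and 3. *)
Lemma graph9_classification :
  all (fun b => all (fun c => if (C5_form b c < 0)%R then all (fun d =>
    if (C5_form b d < 0)%R then if (C5_form c d < 0)%R then
      has (fun p => contains edges1 (graph9 [:: b; c; d]) p ||
                    contains edges2 (graph9 [:: b; c; d]) p) relabellings
    else true else true) (bitstrings 5) else true) (bitstrings 5)) (bitstrings 5).
Proof. by vm_compute. Qed.

Lemma K5_minor_contract_seq (T : eqType) (e : rel T) (s : seq T) :
  uniq s -> size s = 5 -> all (fun x => all (fun y => (x != y) ==> e x y) s) s ->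
  has_K5_minor e.
Proof.
move=> us ss /allP clq; apply: (K5_minor_base us ss) => x y xs ys xy.
by have /allP/(_ y ys)/implyP := clq x xs; apply.
Qed.

Definition rel9 (E : seq (nat * nat)) : rel 'I_9 := fun i j => sym_rel E i j.

(** The branch sets are {4}, {5}, {2, 6, 7}, {1, 8} and {0, 3}. *)
Lemma edges1_K5_minor : has_K5_minor (rel9 edges1).
Proof.
pose o i (lti : i < 9) := Ordinal lti.
apply: (@K5_minor_contract _ _ (@o 6 isT) (@o 7 isT)) => //.
apply: (@K5_minor_contract _ _ (@o 6 isT) (@o 2 isT)) => //.
apply: (@K5_minor_contract _ _ (@o 8 isT) (@o 1 isT)) => //.
apply: (@K5_minor_contract _ _ (@o 3 isT) (@o 0 isT)) => //.
by apply: (@K5_minor_contract_seq _ _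
  [:: @o 4 isT; @o 5 isT; @o 6 isT; @o 8 isT; @o 3 isT]).
Qed.

(** The branch sets are {2}, {7}, {8}, {1, 4, 5} and {0, 3, 6}. *)
Lemma edges2_K5_minor : has_K5_minor (rel9 edges2).
Proof.
pose o i (lti : i < 9) := Ordinal lti.
apply: (@K5_minor_contract _ _ (@o 4 isT) (@o 5 isT)) => //.
apply: (@K5_minor_contract _ _ (@o 4 isT) (@o 1 isT)) => //.
apply: (@K5_minor_contract _ _ (@o 6 isT) (@o 3 isT)) => //.
apply: (@K5_minor_contract _ _ (@o 6 isT) (@o 0 isT)) => //.
by apply: (@K5_minor_contract_seq _ _
  [:: @o 4 isT; @o 7 isT; @o 8 isT; @o 2 isT; @o 6 isT]).
Qed.

(** * The parity count for K5 *)

Lemma big_addb_twice (T : eqType) (F : T -> bool) (s t : seq T) :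
  perm_eq t (s ++ s) -> \big[addb/false]_(i <- t) F i = false.
Proof. by move=> ts; rewrite (perm_big _ ts) big_cat /= addbb. Qed.

(** The 15 unordered pairs of independent edges of K5; [(i, j, k, l)] stands for the edges [ij] and
    [kl]. *)
Definition quads := [:: (0, 1, 2, 3); (0, 2, 1, 3); (0, 3, 1, 2);
  (0, 1, 2, 4); (0, 2, 1, 4); (0, 4, 1, 2); (0, 1, 3, 4); (0, 3, 1, 4); (0, 4, 1, 3);
  (0, 2, 3, 4); (0, 3, 2, 4); (0, 4, 2, 3); (1, 2, 3, 4); (1, 3, 2, 4); (1, 4, 2, 3)].

(** Read [x i j] as: vertex [i] is left of vertex [j]; and [D i j k] as: the loop closing edge [ij]
    encloses [k]. Each [D] term occurs twice, once for each choice of the fourth vertex, and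
    cancels. Each pair of vertices occurs six times, so the actual order is immaterial; for the
    standard order the sum counts the 5 interleaved pairs of edges, one per set of four vertices. *)
Lemma K5_parity (D : nat -> nat -> nat -> bool) (x : nat -> nat -> bool) :
  (forall i j, i < j < 5 -> x j i = ~~ x i j) ->
  \big[addb/false]_(q <- quads) (let: (i, j, k, l) := q in
    x i k (+) x j k (+) (x i l (+) x j l)
    (+) (D i j k (+) D i j l) (+) (D k l i (+) D k l j)) = true.
Proof.
move=> x_neg.
pose dq (q : nat * nat * nat * nat) := let: (i, j, k, l) := q in
  [:: (i, j, k); (i, j, l); (k, l, i); (k, l, j)].
pose xq (q : nat * nat * nat * nat) := let: (i, j, k, l) := q in
  [:: (i, k); (j, k); (i, l); (j, l)].
pose dF t := D t.1.1 t.1.2 t.2.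
pose sgn (t : nat * nat) := t.2 < t.1.
pose xF (t : nat * nat) := x (minn t.1 t.2) (maxn t.1 t.2).
pose pairs := flatten (map xq quads).
have -> : \big[addb/false]_(q <- quads) (let: (i, j, k, l) := q in
    x i k (+) x j k (+) (x i l (+) x j l)
    (+) (D i j k (+) D i j l) (+) (D k l i (+) D k l j)) =
  \big[addb/false]_(q <- quads) \big[addb/false]_(t <- xq q) (sgn t (+) xF t)
  (+) \big[addb/false]_(q <- quads) \big[addb/false]_(t <- dq q) dF t.
  have sx : all (fun t => [&& t.1 != t.2, t.1 < 5 & t.2 < 5]) pairs by [].
  rewrite -big_split /= big_seq_cond [RHS]big_seq_cond; apply: eq_bigr => q.
  rewrite andbT => qQ.
  have xE t : t \in xq q -> sgn t (+) xF t = x t.1 t.2.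
    move=> tq; have /(allP sx) : t \in pairs by apply/flattenP; exists (xq q); rewrite ?map_f.
    case: t {tq} => i j /= /and3P[ij i5 j5]; rewrite /sgn /xF /=.
    by case: (ltngtP i j) ij => // ji _; rewrite (x_neg j i) ?ji.
  rewrite [\big[addb/false]_(t <- xq q) _]big_seq (eq_bigr _ xE) -big_seq.
  case: q {qQ xE} => [[[i j] k] l]; rewrite !big_cons !big_nil /dF /= !addbF.
  by rewrite !addbA.
have fl (T : Type) (g : nat * nat * nat * nat -> seq T) (F : T -> bool) :
    \big[addb/false]_(q <- quads) \big[addb/false]_(t <- g q) F t =
    \big[addb/false]_(t <- flatten (map g quads)) F t by rewrite big_flatten big_map.
rewrite !fl big_split /=.
have -> : \big[addb/false]_(t <- flatten (map dq quads)) dF t = false.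
  exact: (@big_addb_twice _ _ (undup (flatten (map dq quads)))).
have -> : \big[addb/false]_(t <- flatten (map xq quads)) xF t = false.
  pose ord (t : nat * nat) := (minn t.1 t.2, maxn t.1 t.2).
  rewrite -(big_map ord xpredT (fun t => x t.1 t.2)).
  (* Each of the ten sorted pairs occurs six times, that is, twice in three copies of [s]. *)
  pose s := undup (map ord pairs).
  exact: (@big_addb_twice _ _ (s ++ s ++ s)).
by rewrite !addbF !big_cons big_nil.
Qed.

(** * Crossing parities of polylines *)

Local Open Scope ring_scope.

Definition grid_point := (int * int)%type.

(* The step from [p] to [p'] runs horizontally at height [p.2] and then
   vertically at abscissa [p'.1]; [cross] is the parity of the number of
   crossings of two steps with pairwise distinct coordinates. *)
Definition cross (p p' q q' : grid_point) : bool :=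
  ((p.1 < q'.1) (+) (p'.1 < q'.1)) && ((q.2 < p.2) (+) (q'.2 < p.2)) (+)
  ((q.1 < p'.1) (+) (q'.1 < p'.1)) && ((p.2 < q.2) (+) (p'.2 < q.2)).

Fixpoint step_crossings p (s : seq grid_point) q q' : bool :=
  if s is p' :: s' then cross p p' q q' (+) step_crossings p' s' q q' else false.

Fixpoint crossings p s q (t : seq grid_point) : bool :=
  if t is q' :: t' then step_crossings p s q q' (+) crossings p s q' t' else false.

(* [above p s a] is the winding parity around [a]: it counts the horizontal
   segments above [a]. *)
Fixpoint above p (s : seq grid_point) (a : grid_point) : bool :=
  if s is p' :: s' then
    ((p.1 < a.1) (+) (p'.1 < a.1)) && (a.2 < p.2) (+) above p' s' a
  else false.

Definition generic (s t : seq grid_point) :=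
  forall p q, p \in s -> q \in t -> p.1 != q.1 /\ p.2 != q.2.

Lemma addbE a b : a (+) b = xorb a b. Proof. by case: a; case: b. Qed.

Lemma generic_sym s t : generic s t -> generic t s.
Proof. by move=> st p q ps qt; have [] := st q p qt ps; split; rewrite eq_sym. Qed.

Lemma cross_sym p p' q q' : cross p p' q q' = cross q q' p p'.
Proof. exact: addbC. Qed.

Lemma crossings_cons p p' s q t :
  crossings p (p' :: s) q t = step_crossings q t p p' (+) crossings p' s q t.
Proof.
elim: t q => [|q' t IH] q //=.
by rewrite IH (cross_sym q) addbACA.
Qed.

Lemma crossings_nil p q t : crossings p [::] q t = false.
Proof. by elim: t q => //= q' t IH q; rewrite IH. Qed.

Lemma crossings_sym p s q t : crossings p s q t = crossings q t p s.
Proof.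
elim: s p => [|p' s IH] p; first by rewrite crossings_nil.
by rewrite crossings_cons IH.
Qed.

(** A crossing is a difference of potentials: whether the horizontal part of [pp'] lies above [a]
    and above [b], and whether the horizontal part of [ab] lies below [p] and below [p']. The last
    two terms telescope along a polyline. *)
Lemma cross_potential p p' a b : generic [:: p; p'] [:: a; b] ->
  cross p p' a b = ((p.1 < a.1) (+) (p'.1 < a.1)) && (a.2 < p.2)
    (+) (((p.1 < b.1) (+) (p'.1 < b.1)) && (b.2 < p.2))
    (+) (((p.1 < a.1) (+) (p.1 < b.1)) && (a.2 < p.2))
    (+) (((p'.1 < a.1) (+) (p'.1 < b.1)) && (a.2 < p'.2)).
Proof.
move=> gen; rewrite /cross.
have neg (x y : int) : x != y -> (y < x) = ~~ (x < y) by lia.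
have [pa1 pa2] := gen p a (mem_head _ _) (mem_head _ _).
have p'in : p' \in [:: p; p'] by rewrite !inE eqxx orbT.
have bin : b \in [:: a; b] by rewrite !inE eqxx orbT.
have [p'a1 p'a2] := gen p' a p'in (mem_head _ _).
have [p'b1 p'b2] := gen p' b p'in bin.
rewrite (neg p'.1 a.1) // (neg p'.1 b.1) // (neg a.2 p.2) 1?eq_sym //.
rewrite (neg a.2 p'.2) 1?eq_sym //.
by rewrite !addbE; btauto.
Qed.

Lemma generic_sub s s' t t' : {subset s' <= s} -> {subset t' <= t} ->
  generic s t -> generic s' t'.
Proof. by move=> ss tt st p q /ss ps /tt; apply: st. Qed.

Lemma step_crossings_above p s a b : generic (p :: s) [:: a; b] ->
  step_crossings p s a b = above p s a (+) above p s b
    (+) (((p.1 < a.1) (+) (p.1 < b.1)) && (a.2 < p.2))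
    (+) ((((last p s).1 < a.1) (+) ((last p s).1 < b.1)) && (a.2 < (last p s).2)).
Proof.
elim: s p => [|p' s IH] p gen /=; first by rewrite addbb.
rewrite cross_potential; last first.
  by apply: generic_sub gen => // q; rewrite !inE => /orP[]->; rewrite ?orbT.
rewrite IH; last by apply: generic_sub gen => // q qs; rewrite inE qs orbT.
by rewrite !addbE; btauto.
Qed.

(* Two polylines with the same ends form a closed curve, which a polyline from
   [q] to [last q t] crosses with the parity of the difference of the winding
   parities of [q] and of [last q t]. *)
Lemma crossings_above p s s' q t : last p s = last p s' ->
  generic (p :: s) (q :: t) -> generic (p :: s') (q :: t) ->
  crossings p s q t (+) crossings p s' q t =
    above p s q (+) above p s' q
    (+) (above p s (last q t) (+) above p s' (last q t)).
Proof.
move=> ss'; elim: t q => [|q' t IH] q gen gen' /=; first by rewrite addbb.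
have sub1 : {subset [:: q; q'] <= [:: q, q' & t]}.
  by move=> z; rewrite !inE => /orP[]->; rewrite ?orbT.
have sub2 : {subset q' :: t <= [:: q, q' & t]}.
  by move=> z zs; rewrite inE zs orbT.
rewrite addbACA IH; [|exact: generic_sub gen|exact: generic_sub gen'].
rewrite !step_crossings_above; [|exact: generic_sub gen'|exact: generic_sub gen].
rewrite -ss'.
by rewrite !addbE; btauto.
Qed.

Definition arch (p q : grid_point) (h : int) := [:: (p.1, h); q].

Definition interleaved (k l m n : grid_point) : bool :=
  (k.1 < m.1) (+) (l.1 < m.1) (+) ((k.1 < n.1) (+) (l.1 < n.1)).

(** Only the horizontal part of the lower arch can meet the other arch, namely in the legs of the
    higher one. *)
Lemma arch_crossings k l m n h h' : generic [:: k; l] [:: m; n] -> h != h' ->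
  {in [:: k; l; m; n], forall p : grid_point, p.2 < h /\ p.2 < h'} ->
  crossings k (arch k l h) m (arch m n h') = interleaved k l m n.
Proof.
move=> gen hh' high.
have neg (x y : int) : x != y -> (y < x) = ~~ (x < y) by lia.
have E (x y : int) : x < y -> ((x < y) = true) * ((y < x) = false).
  by move=> xy; split; lia.
have kin : k \in [:: k; l] by rewrite !inE eqxx.
have lin : l \in [:: k; l] by rewrite !inE eqxx orbT.
have min : m \in [:: m; n] by rewrite !inE eqxx.
have nin : n \in [:: m; n] by rewrite !inE eqxx orbT.
have /high[kh kh'] : k \in [:: k; l; m; n] by rewrite mem_head.
have /high[lh lh'] : l \in [:: k; l; m; n] by rewrite !inE eqxx !orbT.
have /high[mh mh'] : m \in [:: k; l; m; n] by rewrite !inE eqxx !orbT.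
have /high[nh nh'] : n \in [:: k; l; m; n] by rewrite !inE eqxx !orbT.
rewrite /crossings /step_crossings /arch /cross /interleaved /=.
rewrite !(E _ _ kh, E _ _ lh, E _ _ mh, E _ _ nh, E _ _ kh', E _ _ lh',
          E _ _ mh', E _ _ nh').
have [km _] := gen k m kin min; have [kn _] := gen k n kin nin.
have [lm _] := gen l m lin min; have [ln _] := gen l n lin nin.
rewrite (neg k.1 m.1) // (neg k.1 n.1) // (neg l.1 m.1) // (neg l.1 n.1) //.
rewrite (neg h h') //.
by rewrite !addbE; btauto.
Qed.

Definition enclosed k s (h : int) (a : grid_point) : bool :=
  above k s a (+) above k (arch k (last k s) h) a.

(** The polylines are replaced by arches one after the other. By [crossings_above], each replacement
    changes the parity by the winding parities of the closed loop around the two ends of the other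
    curve. *)
Lemma crossings_interleaved k s m t h h' :
  generic (k :: s) (m :: t) -> h != h' ->
  {in k :: s ++ m :: t, forall p : grid_point, p.2 < h /\ p.2 < h'} ->
  crossings k s m t = interleaved k (last k s) m (last m t)
    (+) (enclosed k s h m (+) enclosed k s h (last m t))
    (+) (enclosed m t h' k (+) enclosed m t h' (last k s)).
Proof.
move=> gen hh' high; rewrite /enclosed.
set l := last k s; set n := last m t.
have lin : l \in k :: s by apply: mem_last.
have nin : n \in m :: t by apply: mem_last.
have kin := mem_head k s; have min := mem_head m t.
have highk p : p \in k :: s -> p.2 < h /\ p.2 < h'.
  by move=> ps; apply: high; rewrite -cat_cons mem_cat ps.
have highm p : p \in m :: t -> p.2 < h /\ p.2 < h'.
  by move=> ps; apply: high; rewrite -cat_cons mem_cat ps orbT.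
have gen1 : generic (k :: arch k l h) (m :: t).
  move=> p q; rewrite !inE => /or3P[]/eqP-> qt; [exact: gen| |exact: gen].
  have [-> _] := gen _ _ kin qt; split=> //=.
  by have [qh _] := highm q qt; rewrite gt_eqF.
have gen2 : generic (m :: arch m n h') (k :: arch k l h).
  move=> q p; rewrite /arch !in_cons !in_nil !orbF => /or3P[]/eqP-> ps.
  - by apply: (generic_sym gen1 min); rewrite /arch !in_cons in_nil orbF.
  - have : p.1 != m.1 /\ p.2 != h'.
      move: ps => /or3P[]/eqP->; have [_ kh] := highk _ kin; have [_ lh] := highk _ lin.
      + by have [-> _] := gen _ _ kin min; rewrite lt_eqF.
      + by have [-> _] := gen _ _ kin min.
      + by have [-> _] := gen _ _ lin min; rewrite lt_eqF.
    case=> pm ph; split; rewrite eq_sym; [exact: pm|exact: ph].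
  - by apply: (generic_sym gen1 nin); rewrite /arch !in_cons in_nil orbF.
have genc : generic [:: k; l] [:: m; n].
  by move=> p q; rewrite !inE => /orP[]/eqP-> /orP[]/eqP->; apply: gen.
have A1 : crossings k s m t = crossings k (arch k l h) m t (+)
    (crossings k s m t (+) crossings k (arch k l h) m t).
  by rewrite addbCA addbb addbF.
rewrite A1 crossings_above // crossings_sym.
have A2 : crossings m t k (arch k l h) = crossings m (arch m n h') k (arch k l h) (+)
    (crossings m t k (arch k l h) (+) crossings m (arch m n h') k (arch k l h)).
  by rewrite addbCA addbb addbF.
rewrite A2 crossings_above //; last exact: generic_sym.
rewrite [crossings m _ _ _]crossings_sym arch_crossings //; last first.
  by move=> p; rewrite !inE => /or4P[]/eqP->; [exact: highk|exact: highk|exact: highm|exact: highm].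
by rewrite addbAC.
Qed.

(** If all parities vanished, summing [crossings_interleaved] over [quads] would give false,
    contrary to [K5_parity]. *)
Theorem K5_polylines_cross (v : nat -> grid_point) (P : nat -> nat -> seq grid_point) :
  (forall i j, (i < j < 5)%N -> last (v i) (P i j) = v j) ->
  (forall i j k l, (i < j < 5)%N -> (k < l < 5)%N -> uniq [:: i; j; k; l] ->
    generic (v i :: P i j) (v k :: P k l)) ->
  ~ (forall i j k l, (i < j < 5)%N -> (k < l < 5)%N -> uniq [:: i; j; k; l] ->
    crossings (v i) (P i j) (v k) (P k l) = false).
Proof.
move=> lastP gen nocross.
pose all_points := flatten [seq v i :: P i j | i <- iota 0 5, j <- iota 0 5].
have [H Hhigh] : exists H : int, {in all_points, forall p, p.2 < H}.
  elim: all_points => [|p s [H IH]]; first by exists 0.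
  exists (Order.max H (p.2 + 1)) => q; rewrite inE => /orP[/eqP->|/IH qH].
    by rewrite lt_max ltrDl ltr01 orbT.
  by rewrite lt_max qH.
(* Above all points, and distinct for distinct edges, since [5 * i + j] is injective on indices
   below 5. *)
pose h i j := H + (5 * i + j)%:Z.
pose D i j r := enclosed (v i) (P i j) (h i j) (v r).
have mem_all_points i j p : (i < 5)%N -> (j < 5)%N -> p \in v i :: P i j -> p \in all_points.
  move=> i5 j5 ps; apply/flattenP; exists (v i :: P i j) => //.
  by apply/allpairsP; exists (i, j); rewrite !mem_iota.
have main i j k l : (i < j < 5)%N -> (k < l < 5)%N -> uniq [:: i; j; k; l] ->
    interleaved (v i) (v j) (v k) (v l) (+) (D i j k (+) D i j l)
    (+) (D k l i (+) D k l j) = false.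
  move=> ij kl ijkl; rewrite -[RHS](nocross i j k l) //.
  rewrite (@crossings_interleaved _ _ _ _ (h i j) (h k l)) ?lastP //; first exact: gen.
    have ne : (5 * i + j != 5 * k + l)%N by move: ijkl; rewrite /= !inE !negb_or; lia.
    by rewrite /h (inj_eq (addrI _)).
  move=> p ps; suff pH : p.2 < H by rewrite /h; split; apply: lt_le_trans pH _; rewrite lerDl.
  apply: Hhigh; move: ps; rewrite -cat_cons mem_cat => /orP[]; apply: mem_all_points; lia.
have neg i j k l a b : (i < j < 5)%N -> (k < l < 5)%N -> uniq [:: i; j; k; l] ->
    a \in [:: i; j] -> b \in [:: k; l] -> ((v b).1 < (v a).1) = ~~ ((v a).1 < (v b).1).
  move=> ij kl ijkl aij bkl.
  have inP m o c : (m < o < 5)%N -> c \in [:: m; o] -> v c \in v m :: P m o.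
    move=> mo; rewrite !inE => /orP[]/eqP->; rewrite ?eqxx //.
    by rewrite -(lastP m o mo) -in_cons mem_last.
  have [ab _] := gen _ _ _ _ ij kl ijkl _ _ (inP _ _ _ ij aij) (inP _ _ _ kl bkl).
  by case: (ltgtP (v a).1 (v b).1) ab.
(* Genericity only compares points of independent edges, so [i] and [j] are compared through two
   independent edges ending at them. *)
have lt_neg i j : (i < j < 5)%N -> ((v j).1 < (v i).1) = ~~ ((v i).1 < (v j).1).
  move: i j => [|[|[|[|[|i]]]]] [|[|[|[|[|j]]]]] //; last by rewrite andbF.
  - by move=> _; apply: (neg 0%N 2%N 1%N 3%N).
  - by move=> _; apply: (neg 0%N 1%N 2%N 3%N).
  - by move=> _; apply: (neg 0%N 1%N 2%N 3%N).
  - by move=> _; apply: (neg 0%N 1%N 2%N 4%N).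
  - by move=> _; apply: (neg 0%N 1%N 2%N 3%N).
  - by move=> _; apply: (neg 0%N 1%N 2%N 3%N).
  - by move=> _; apply: (neg 0%N 1%N 2%N 4%N).
  - by move=> _; apply: (neg 0%N 2%N 1%N 3%N).
  - by move=> _; apply: (neg 0%N 2%N 1%N 4%N).
  - by move=> _; apply: (neg 0%N 3%N 1%N 4%N).
have := K5_parity D (x := fun i j => (v i).1 < (v j).1) lt_neg.
rewrite big_seq big1 // => -[[[i j] k] l] q.
have quadsP : all (fun '(i, j, k, l) => [&& (i < j < 5)%N, (k < l < 5)%N &
  uniq [:: i; j; k; l]]) quads by [].
by have /and3P[ij kl ijkl] := allP quadsP _ q; apply: main.
Qed.

(** * Grid drawings and their contractions *)

Definition grid_near (d : int) : rel grid_point := fun p q =>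
  (`|p.1 - q.1| <= d) && (`|p.2 - q.2| <= d).

(** A crossing point lies within [d] of [p] and within [d] of [q]. *)
Lemma cross_far d p p' q q' :
  grid_near d p p' -> grid_near d q q' -> ~~ grid_near (d + d) p q -> cross p p' q q' = false.
Proof.
case: p p' q q' => [p1 p2] [p1' p2'] [q1 q2] [q1' q2']; rewrite /grid_near /cross /=.
move=> pp qq pq; apply/negP; rewrite !addbE => H.
have {H} : (xorb (p1 < q1') (p1' < q1') /\ xorb (q2 < p2) (q2' < p2)) \/
         (xorb (q1 < p1') (q1' < p1') /\ xorb (p2 < q2) (p2' < q2)).
  by case: (xorb (p1 < _) _) (xorb (q2 < _) _) (xorb (q1 < _) _) (xorb (p2 < _) _) H
    => [] [] [] []; auto.
move=> [] []; rewrite -!addbE.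
  by case: (ltP p1 q1'); case: (ltP p1' q1'); case: (ltP q2 p2); case: (ltP q2' p2) => //=; lia.
by case: (ltP q1 p1'); case: (ltP q1' p1'); case: (ltP p2 q2); case: (ltP p2' q2) => //=; lia.
Qed.

Lemma crossings_far d p s q t : path (grid_near d) p s -> path (grid_near d) q t ->
  {in p :: s & q :: t, forall a b, ~~ grid_near (d + d) a b} -> crossings p s q t = false.
Proof.
move=> ps; elim: t q => //= q' t IH q /andP[qq' q't] far.
rewrite IH //; last by move=> a b aps bt; apply: far => //; rewrite inE bt orbT.
rewrite addbF; have {}far : {in p :: s, forall a, ~~ grid_near (d + d) a q}.
  by move=> a aps; apply: far => //; apply: mem_head.
elim: s p ps {IH} far => //= p' s IHs p /andP[pp' p's] far.
rewrite IHs //; last by move=> a aps; apply: far; rewrite inE aps orbT.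
by rewrite addbF (@cross_far d) //; apply: far; apply: mem_head.
Qed.

(* The integral distance 5 is large enough to keep independent edges disjoint
   when the grid is refined to put them in general position. *)
Definition grid_drawing (T : eqType) (e : rel T) : Prop :=
  exists (v : T -> grid_point) (P : T -> T -> seq grid_point),
    (forall x y, e x y -> path (grid_near 1) (v x) (P x y) /\ last (v x) (P x y) = v y) /\
    (forall x y z t, e x y -> e z t -> [&& x != z, x != t, y != z & y != t] ->
       {in v x :: P x y & v z :: P z t, forall p q, ~~ grid_near 4 p q}).

(** The merged vertex stays at [a], and edges inherited from [b] are routed along the polylines
    between [a] and [b]. Only edges at [a] use old edges at [b], so independent edges of the
    contraction follow independent edges of [e]. *)
Lemma grid_drawing_contract (T : eqType) (e : rel T) a b : symmetric e ->
  e a b -> grid_drawing e -> grid_drawing (contract a b e).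
Proof.
move=> e_sym ab [v [P [Ppath Pfar]]].
have ba : e b a by rewrite e_sym.
pose Q x y := if e x y then P x y else
  if (x == a) && e b y then P a b ++ P b y else P x b ++ P b a.
exists v, Q; split.
  move=> x y /and4P[_ _ _]; rewrite /Q; case: ifP => [xy _|_ /=]; first exact: Ppath.
  have [Pab lab] := Ppath a b ab; have [Pba lba] := Ppath b a ba.
  case: ifP => [/andP[/eqP-> by_] _|_ /= /andP[/eqP-> xb]].
    by have [Pby lby] := Ppath b y by_; rewrite cat_path last_cat lab Pab.
  by have [Pxb lxb] := Ppath x b xb; rewrite cat_path last_cat lxb Pxb.
have QP x y p : contract a b e x y -> p \in v x :: Q x y ->
    exists c d, [/\ e c d, p \in v c :: P c d,
      (c \in [:: x; y]) || (c == b) && (a \in [:: x; y]) &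
      (d \in [:: x; y]) || (d == b) && (a \in [:: x; y])].
  move=> /and4P[_ _ _]; rewrite /Q; case: ifP => [xy _ pP|_ /=].
    by exists x, y; split => //; rewrite !inE eqxx ?orbT.
  case: ifP => [/andP[/eqP-> by_] _|_ /= /andP[/eqP-> xb]].
    rewrite -cat_cons mem_cat => /orP[pP|pP].
      by exists a, b; split => //; rewrite !inE !eqxx ?orbT.
    by exists b, y; split => //; rewrite !inE ?pP ?eqxx ?orbT.
  rewrite -cat_cons mem_cat => /orP[pP|pP].
    by exists x, b; split => //; rewrite !inE ?eqxx ?orbT.
  by exists b, a; split => //; rewrite !inE ?pP ?eqxx ?orbT.
move=> x y z t xy zt /and4P[xz xt yz yt] p q /(QP _ _ _ xy)[c [d [cd pcd hc hd]]].
move=> /(QP _ _ _ zt)[c' [d' [cd' qcd hc' hd']]].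
have [/and3P[xb yb _] /and3P[zb tb _]] : [&& x != b, y != b & true] /\ [&& z != b, t != b & true].
  by case/and4P: xy => -> -> _ _; case/and4P: zt => -> -> _ _.
have sep m n : (m \in [:: x; y]) || (m == b) && (a \in [:: x; y]) ->
    (n \in [:: z; t]) || (n == b) && (a \in [:: z; t]) -> m != n.
  rewrite !inE => Hm; apply: contraTneq => <-; apply/negP => Hn.
  case/orP: Hm => [/orP[]/eqP E|/andP[/eqP E /orP[]/eqP aE]];
    move: Hn; rewrite E ?aE ?(negPf xz, negPf xt, negPf yz, negPf yt, negPf xb, negPf yb) //.
  - by rewrite !(eq_sym b) (negPf zb) (negPf tb) andbF.
  - by rewrite !(eq_sym b) (negPf zb) (negPf tb) andbF.
by apply: (Pfar c d c' d') => //; apply/and4P; split; apply: sep.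
Qed.

(** Different shifts below 32 give different residues modulo 32, hence general position. Vertex [i]
    receives the shift [25 + i], and the inside of edge [ij] the shift [5 * i + j]. *)
Definition refine (c : nat) (p : grid_point) : grid_point := (32 * p.1 + c%:Z, 32 * p.2 + c%:Z).

(** A unit step grows to at most 32 + 31 = 63. The last point is repeated with the shift of the end
    vertex. *)
Lemma path_refine (c0 c c1 : nat) p s : (c0 < 32)%N -> (c < 32)%N -> (c1 < 32)%N ->
  path (grid_near 1) p s ->
  path (grid_near 63) (refine c0 p) (rcons (map (refine c) s) (refine c1 (last p s))).
Proof.
move=> lc0 lc lc1; elim: s p c0 lc0 => [|q s IH] p c0 lc0 /=.
  by move=> _; rewrite /grid_near /refine /=; lia.
by case/andP=> pq qs; rewrite IH // andbT; move: pq; rewrite /grid_near /refine /=; lia.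
Qed.

Lemma no_K5_grid_drawing (T : eqType) (e : rel T) (s : seq T) :
  uniq s -> size s = 5%N -> {in s &, forall x y, x != y -> e x y} -> ~ grid_drawing e.
Proof.
case: s => // x0 s0; set s := x0 :: s0 => s_uniq ss se [v [P [Ppath Pfar]]].
pose w i := refine (25 + i) (v (nth x0 s i)).
pose Q i j := rcons (map (refine (5 * i + j)) (P (nth x0 s i) (nth x0 s j))) (w j).
have sij i j : (i < j < 5)%N -> e (nth x0 s i) (nth x0 s j).
  move=> /andP[ij j5]; have i5 := ltn_trans ij j5.
  by apply: se; rewrite ?mem_nth ?ss // nth_uniq ?ss // ltn_eqF.
have QP i j p : (i < j < 5)%N -> p \in w i :: Q i j ->
    exists c q, [/\ (c \in [:: 25 + i; 5 * i + j; 25 + j])%N, p = refine c q &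
      q \in v (nth x0 s i) :: P (nth x0 s i) (nth x0 s j)].
  move=> ij; rewrite /Q inE mem_rcons inE => /or3P[/eqP->|/eqP->|/mapP[q qP ->]].
  - by exists (25 + i)%N, (v (nth x0 s i)); rewrite !inE !eqxx.
  - exists (25 + j)%N, (v (nth x0 s j)); split => //; first by rewrite !inE eqxx !orbT.
    by have [_ <-] := Ppath _ _ (sij _ _ ij); apply: mem_last.
  - by exists (5 * i + j)%N, q; rewrite !inE eqxx orbT qP orbT.
have class i j k l c d : (i < j < 5)%N -> (k < l < 5)%N -> uniq [:: i; j; k; l] ->
    (c \in [:: 25 + i; 5 * i + j; 25 + j])%N -> (d \in [:: 25 + k; 5 * k + l; 25 + l])%N ->
    [&& c != d, c < 32 & d < 32]%N.
  by rewrite /= !inE !negb_or; lia.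
apply: (@K5_polylines_cross w Q) => [i j ij|i j k l ij kl ijkl|i j k l ij kl ijkl].
- by rewrite /Q last_rcons.
- move=> p q /(QP _ _ _ ij)[c [p' [cP -> _]]] /(QP _ _ _ kl)[d [q' [dP -> _]]].
  have /and3P[cd c32 d32] := class _ _ _ _ _ _ ij kl ijkl cP dP.
  by rewrite /refine /=; split; lia.
have Qpath a b : (a < b < 5)%N -> path (grid_near 63) (w a) (Q a b).
  move=> ab; have [Pab lab] := Ppath _ _ (sij _ _ ab).
  by rewrite /Q /w -lab; apply: path_refine => //; lia.
(* A distance of at least 5 becomes at least 32 * 5 - 31 = 129, more than 63 + 63; a distance of 4
   would not do. *)
apply: (@crossings_far 63); try exact: Qpath.
move=> p q /(QP _ _ _ ij)[c [p' [cP -> p'P]]] /(QP _ _ _ kl)[d [q' [dP -> q'P]]].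
have /and3P[cd c32 d32] := class _ _ _ _ _ _ ij kl ijkl cP dP.
have : ~~ grid_near 4 p' q'.
  apply: Pfar (sij _ _ ij) (sij _ _ kl) _ _ _ p'P q'P.
  rewrite !nth_uniq ?ss //; move: ijkl; rewrite /= !inE !negb_or; lia.
by rewrite /grid_near /refine /=; lia.
Qed.

Theorem grid_drawing_no_K5_minor (T : eqType) (e : rel T) : symmetric e ->
  grid_drawing e -> ~ has_K5_minor e.
Proof.
move=> e_sym e_drawn eK; elim: eK e_sym e_drawn => {e} [e s s_uniq ss se|e a b ab _ IH] e_sym.
  exact: no_K5_grid_drawing s_uniq ss se.
by move=> e_drawn; apply: IH; [exact: contract_sym | exact: grid_drawing_contract].
Qed.

(** * Positive definite subspaces *)

Section Support.
Variables (R : fieldType) (n : nat).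
Implicit Types (W : {set 'I_n}) (x : 'rV[R]_n).

Definition unitv (i : 'I_n) : 'rV[R]_n := delta_mx 0 i.

Definition supp W : 'M[R]_n := (\sum_(i in W) <<unitv i>>)%MS.

Lemma unitvE i j : unitv i 0 j = (j == i)%:R.
Proof. by rewrite mxE eqxx. Qed.

Lemma rank_supp W : \rank (supp W) = #|W|.
Proof.
have /mxdirectP /= -> := @mxdirect_delta R _ (mem W) n id (in2W (@inj_id _)).
rewrite -sum1_card; apply: eq_bigr => i _.
by rewrite mxrank_gen mxrank_delta.
Qed.

Lemma suppP W x : reflect (forall i, i \notin W -> x 0 i = 0) (x <= supp W)%MS.
Proof.
apply: (iffP idP) => [xW i iW|x0].
  have : (supp W <= kermx (delta_mx i (0 : 'I_1) : 'cV[R]_n))%MS.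
    apply/sumsmx_subP => j jW; rewrite genmxE sub_kermx mul_delta_mx_cond.
    by case: (j =P i) => [ji|_]; [rewrite -ji jW in iW | rewrite mulr0n].
  move=> /(submx_trans xW); rewrite sub_kermx => /eqP/matrixP/(_ 0 0).
  by rewrite -colE !mxE.
rewrite (row_sum_delta x); apply: summx_sub => i _.
have [iW|/x0->] := boolP (i \in W); last by rewrite scale0r sub0mx.
by apply/scalemx_sub/(sumsmx_sup i) => //; rewrite genmxE.
Qed.

Lemma supp_sub W W' : W \subset W' -> (supp W <= supp W')%MS.
Proof.
move=> WW'; apply/sumsmx_subP => i iW.
by apply: (sumsmx_sup i) => //; apply: (subsetP WW').
Qed.

Lemma unitv_supp W i : i \in W -> (unitv i <= supp W)%MS.
Proof.
move=> iW; apply/suppP => j jW; rewrite unitvE.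
by case: eqP => // ji; rewrite ji iW in jW.
Qed.

End Support.
Arguments supp R {n} W.
Arguments unitv R {n} i.
Arguments suppP {R n W x}.

Section Form.
Variables (R : realFieldType) (n : nat) (A : 'M[R]_n).
Implicit Types (W : {set 'I_n}) (x y z : 'rV[R]_n).

Definition form x y : R := (x *m A *m y^T) 0 0.

Lemma formDl x y z : form (x + y) z = form x z + form y z.
Proof. by rewrite /form !mulmxDl mxE. Qed.
Lemma formDr x y z : form z (x + y) = form z x + form z y.
Proof. by rewrite /form linearD /= mulmxDr mxE. Qed.
Lemma formZl a x y : form (a *: x) y = a * form x y.
Proof. by rewrite /form -!scalemxAl mxE. Qed.
Lemma formZr a x y : form x (a *: y) = a * form x y.
Proof. by rewrite /form linearZ /= -scalemxAr mxE. Qed.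
Lemma formNl x y : form (- x) y = - form x y.
Proof. by rewrite -scaleN1r formZl mulN1r. Qed.
Lemma formNr x y : form x (- y) = - form x y.
Proof. by rewrite -scaleN1r formZr mulN1r. Qed.
Lemma form0l y : form 0 y = 0.
Proof. by rewrite /form !mul0mx mxE. Qed.

Lemma form_unitv i j : form (unitv R i) (unitv R j) = A i j.
Proof. by rewrite /form -rowE trmx_delta -colE !mxE. Qed.

Definition posdef m (U : 'M[R]_(m, n)) : Prop :=
  forall x, (x <= U)%MS -> x != 0 -> 0 < form x x.

Definition npos_ge W p : Prop :=
  exists U : 'M[R]_n, [/\ (U <= supp R W)%MS, (p <= \rank U)%N & posdef U].

Lemma npos_ge_le W p q : (q <= p)%N -> npos_ge W p -> npos_ge W q.
Proof. by move=> qp [U [UW pU Upos]]; exists U; split => //; apply: leq_trans pU. Qed.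

Lemma npos_ge_sub W W' p : W \subset W' -> npos_ge W p -> npos_ge W' p.
Proof.
by move=> WW' [U [UW pU Upos]]; exists U; split => //; apply: submx_trans UW (supp_sub _ _).
Qed.

Lemma npos_ge0 W : npos_ge W 0.
Proof.
by exists 0; split => [||x]; rewrite ?sub0mx // submx0 => /eqP-> /eqP.
Qed.

Lemma posdef_nonpos_rank W m l (U : 'M[R]_(m, n)) (L : 'M[R]_(l, n)) :
  (U <= supp R W)%MS -> (L <= supp R W)%MS -> posdef U ->
  (forall x, (x <= L)%MS -> form x x <= 0) -> (\rank U + \rank L <= #|W|)%N.
Proof.
move=> UW LW Upos Lnonpos; rewrite -mxrank_sum_cap -(rank_supp R).
have -> : (U :&: L)%MS = 0.
  apply/eqP/rowV0P => x; rewrite sub_capmx => /andP[xU xL]; apply/eqP.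
  apply: contraT => x0; have := lt_le_trans (Upos x xU x0) (Lnonpos x xL).
  by rewrite ltxx.
by rewrite mxrank0 addn0 mxrankS // addsmx_sub UW.
Qed.

Lemma npos_ge_card W p : npos_ge W p -> (p <= #|W|)%N.
Proof.
case=> U [UW pU Upos]; apply: leq_trans pU _.
rewrite -[X in (X <= _)%N]addn0 -(mxrank0 R n n).
apply: (posdef_nonpos_rank UW (sub0mx _ _)) => // x; rewrite submx0 => /eqP ->.
by rewrite form0l.
Qed.

(** Vanishing on [D] imposes at most |W :&: D| linear conditions. *)
Lemma npos_ge_setD W D p : npos_ge W p -> npos_ge (W :\: D) (p - #|W :&: D|).
Proof.
case=> U [UW pU Upos]; exists (U :&: supp R (W :\: D))%MS.
split; first exact: capmxSr; last first.
  by move=> x; rewrite sub_capmx => /andP[xU _]; apply: Upos.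
have := mxrank_sum_cap U (supp R (W :\: D)).
have : (\rank (U + supp R (W :\: D))%MS <= #|W|)%N.
  by rewrite -(rank_supp R) mxrankS // addsmx_sub UW supp_sub ?subsetDl.
rewrite rank_supp; have := cardsID D W; lia.
Qed.

(** A nonzero vector of [U] killed by [T] would have nonpositive square, so [T] is injective on
    [U]. *)
Lemma npos_ge_image W m (U : 'M[R]_(m, n)) (T : 'M[R]_n) :
  posdef U -> (U *m T <= supp R W)%MS ->
  (forall x, (x <= U)%MS -> form x x <= form (x *m T) (x *m T)) ->
  posdef (U *m T) /\ \rank (U *m T) = \rank U.
Proof.
move=> Upos UTW UT.
have T0 x : (x <= U)%MS -> x != 0 -> 0 < form (x *m T) (x *m T).
  by move=> xU x0; apply: lt_le_trans (Upos x xU x0) (UT x xU).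
split.
  move=> _ /submxP[y ->]; rewrite mulmxA => yUT0; apply: T0; rewrite ?submxMl //.
  by apply: contraNneq yUT0 => ->; rewrite mul0mx.
apply/mxrank_injP/rowV0P => x; rewrite sub_capmx sub_kermx => /andP[xU /eqP xT].
apply/eqP; apply: contraT => x0; have := T0 x xU x0.
by rewrite xT form0l ltxx.
Qed.
End Form.

Section Inertia.
Variables (R : realFieldType) (n : nat) (A : 'M[R]_n).
Hypothesis A_sym : A^T = A.
Implicit Types (W : {set 'I_n}) (x y z : 'rV[R]_n).
Local Notation B := (form A).
Definition nneg_ge W q := npos_ge (- A) W q.

Lemma formN x y : form (- A) x y = - B x y.
Proof. by rewrite /form mulmxN mulNmx mxE. Qed.

Lemma form_sym x y : B x y = B y x.
Proof.
have E : x *m A *m y^T = (y *m A *m x^T)^T by rewrite !trmx_mul trmxK A_sym mulmxA.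
by rewrite /form E mxE.
Qed.

Lemma npos_ge_reduce W p : npos_ge A W p ->
  (exists2 w, w \in W & npos_ge A (W :\ w) p) \/ nneg_ge W (#|W| - p).
Proof.
move=> Wp; have [U [UW pU Upos]] := Wp.
move: pU; rewrite leq_eqVlt => /predU1P[pU|pU]; last first.
  left; have /card_gt0P[w wW] : (0 < #|W|)%N.
    by rewrite -(rank_supp R); apply: leq_trans (mxrankS UW); apply: leq_ltn_trans pU.
  exists w => //; have : npos_ge A (W :\: [set w]) (\rank U - #|W :&: [set w]|).
    by apply: npos_ge_setD; exists U.
  apply: npos_ge_le; have := subset_leq_card (subsetIr W [set w]).
  by rewrite cards1; lia.
pose Uo := (supp R W :&: kermx (A *m U^T))%MS.
have UoP x : (x <= Uo)%MS -> (x <= supp R W)%MS /\ forall y, (y <= U)%MS -> B x y = 0.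
  rewrite sub_capmx sub_kermx => /andP[xW /eqP xU]; split => // _ /submxP[y ->].
  by rewrite /form trmx_mul -!mulmxA (mulmxA A) (mulmxA x) xU mul0mx mxE.
have rUo : (#|W| - p <= \rank Uo)%N.
  have := mxrank_sum_cap (supp R W) (kermx (A *m U^T)).
  have := rank_leq_col (supp R W + kermx (A *m U^T))%MS.
  have := mxrankM_maxr A U^T; rewrite mxrank_tr => AU.
  rewrite rank_supp mxrank_ker pU -/Uo; have := rank_leq_row (A *m U^T).
  move: AU; move: (\rank (_ + _)) (\rank (A *m _)) (\rank Uo) => a b c.
  lia.
have [[z [zUo z0 Bz]]|noz] := EM
    (exists z, [/\ (z <= Uo)%MS, z != 0 & 0 <= B z z]); last first.
  right; exists Uo; split => //; first exact: capmxSl.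
  move=> x xUo x0; rewrite formN oppr_gt0 ltNge; apply/negP => Bx.
  by apply: noz; exists x.
have [zW zU] := UoP z zUo.
have [w zw] : exists w, z 0 w != 0 by apply/rV0Pn.
have wW : w \in W by apply: contraNT zw => /(suppP zW) ->.
left; exists w => //.
pose T : 'M[R]_n := 1%:M - (z 0 w)^-1 *: (delta_mx w 0 *m z).
have TE x : x *m T = x - (x 0 w / z 0 w) *: z.
  rewrite mulmxBr mulmx1 -scalemxAr mulmxA -colE; congr (_ - _).
  rewrite [col w x]mx11_scalar !mxE mul_scalar_mx scalerA mulrC.
  by congr (_ *: _).
have UTW : (U *m T <= supp R (W :\ w))%MS.
  apply/row_subP => i; rewrite row_mul; apply/suppP => j.
  rewrite TE in_setD1 negb_and negbK => /orP[/eqP->|jW].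
    by rewrite !mxE -mulrA mulVf // mulr1 subrr.
  have /suppP/(_ j jW) := submx_trans (row_sub i U) UW; rewrite !mxE => ->.
  by rewrite (suppP zW j jW) mulr0 subr0.
have [|Upos' rU] := npos_ge_image Upos UTW.
  move=> x xU; rewrite TE formDl !formDr !formNl !formNr !formZl !formZr.
  rewrite (form_sym x z) zU //; set t := _ / _.
  by have := mulr_ge0 (sqr_ge0 t) Bz; rewrite expr2; lra.
by exists <<U *m T>>%MS; split;
   [rewrite genmxE | rewrite mxrank_gen rU pU | move=> x; rewrite genmxE; apply: Upos'].
Qed.

Lemma npos_ge_tight W p : npos_ge A W p ->
  exists W', [/\ W' \subset W, npos_ge A W' p & nneg_ge W' (#|W'| - p)].
Proof.
have [m] := ubnP #|W|; elim: m W => // m IH W Wm Wp.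
have [[w wW wp]|Wneg] := npos_ge_reduce Wp; last by exists W.
have [|W' [W'w W'p W'neg]] := IH (W :\ w) _ wp.
  by move: Wm; rewrite (cardsD1 w) wW.
by exists W'; split => //; apply: subset_trans W'w (subsetDl _ _).
Qed.

(* The vectors supported off the neighbourhood of [v], corrected by multiples
   of [v] so as to become orthogonal to [u], are orthogonal to [u - v]. *)
Lemma nneg_ge_nbr W W' u v q : A v v = 0 -> A u u = 0 -> A u v = 1 ->
  u \in W -> v \in W -> W' \subset W -> (forall w, w \in W' -> A w v = 0) ->
  nneg_ge W' q -> nneg_ge W q.+1.
Proof.
move=> Avv Auu Auv uW vW W'W W'v [U [UW' qU Uneg]].
have Avu : A v u = 1 by rewrite -[A]A_sym mxE.
have U_v x : (x <= U)%MS -> B x (unitv R v) = 0.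
  move=> /submx_trans/(_ UW')/suppP xW'; rewrite /form trmx_delta -colE !mxE.
  rewrite big1 // => w _; have [/W'v->|/xW'->] := boolP (w \in W'); first by rewrite mulr0.
  by rewrite mul0r.
pose T : 'M[R]_n := 1%:M - A *m (unitv R u)^T *m unitv R v.
have TE x : x *m T = x - B x (unitv R u) *: unitv R v.
  rewrite mulmxBr mulmx1 !mulmxA; congr (_ - _).
  by rewrite [x *m A *m _]mx11_scalar mul_scalar_mx.
have T_u x : (x <= U)%MS -> B (x *m T) (unitv R u) = 0.
  by move=> xU; rewrite TE formDl formNl formZl form_unitv Avu mulr1 subrr.
have T_v x : (x <= U)%MS -> B (x *m T) (unitv R v) = 0.
  by move=> xU; rewrite TE formDl formNl formZl form_unitv Avv mulr0 subr0 U_v.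
have BT x : (x <= U)%MS -> B (x *m T) (x *m T) = B x x.
  move=> xU; rewrite {2}TE formDr formNr formZr T_v // mulr0 subr0.
  by rewrite TE formDl formNl formZl (form_sym _ x) U_v // mulr0 subr0.
have uW' : u \notin W' by apply/negP => /W'v /eqP; rewrite Auv oner_eq0.
have UTW : (U *m T <= supp R (v |: W'))%MS.
  apply/row_subP => i; rewrite row_mul; apply/suppP => j.
  rewrite TE in_setU1 negb_or => /andP[jv jW'].
  have /suppP/(_ j jW') := submx_trans (row_sub i U) UW'; rewrite !mxE => ->.
  by rewrite eqxx (negPf jv) mulr0 subr0.
have [|Uneg' rU] := npos_ge_image Uneg UTW.
  by move=> x xU; rewrite !formN BT.
have uv : u != v by apply: contra_eq_neq Auv => ->; rewrite Avv eq_sym oner_eq0.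
pose d := unitv R u - unitv R v.
have Bdd : B d d = - 2.
  by rewrite /d formDl !formDr !formNl !formNr !form_unitv Auu Avv Auv Avu; lra.
have u_UT x : (x <= U *m T)%MS -> x 0 u = 0.
  move=> /submx_trans/(_ UTW)/suppP; apply.
  by rewrite in_setU1 negb_or uv.
have d_u : d 0 u = 1 by rewrite !mxE !eqxx (negPf uv) subr0.
exists (<<U *m T>> + <<d>>)%MS; split.
- rewrite addsmx_sub !genmxE (submx_trans UTW) /=; last first.
    by apply: supp_sub; rewrite subUset sub1set vW.
  by rewrite addmx_sub ?eqmx_opp ?unitv_supp.
- rewrite mxrank_disjoint_sum ?mxrank_gen ?rU.
    have : \rank d = 1%N; last by lia.
    apply/eqP; rewrite rank_rV; suff -> : d != 0 by [].
    by apply: contra_eq_neq d_u => ->; rewrite mxE eq_sym oner_eq0.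
  apply/eqP/rowV0P => x; rewrite sub_capmx !genmxE => /andP[/u_UT xu /sub_rVP[a xa]].
  by move: xu; rewrite xa mxE d_u mulr1 => ->; rewrite scale0r.
move=> x /sub_addsmxP[[a b] /= ->] x0; rewrite formN.
set y := a *m _; set z := b *m _ in x0 *.
have yU : (y <= U *m T)%MS by rewrite -(genmxE (U *m T)) submxMl.
have /sub_rVP[c zc] : (z <= d)%MS by rewrite -(genmxE d) submxMl.
have yd : B y d = 0.
  have /submxP[t yt] := yU; rewrite yt mulmxA /d formDr formNr T_u ?T_v ?submxMl //.
  by rewrite subr0.
rewrite zc formDl !formDr !formZl !formZr (form_sym d) yd Bdd !mulr0 addr0 add0r.
have [y0|y0] := eqVneq y 0; last first.
  have := Uneg' y yU y0; rewrite formN; have := sqr_ge0 c; rewrite expr2; lra.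
have c0 : c != 0 by apply: contraNneq x0 => c0; rewrite -/y y0 zc c0 scale0r addr0.
have : 0 < c * c by rewrite -expr2 exprn_even_gt0.
by rewrite y0 form0l; lra.
Qed.
End Inertia.

(** * Spectral theorem for real symmetric matrices *)

Section RealSymmetric.
Variables (R : rcfType) (n : nat) (A : 'M[R]_n).
Hypothesis A_sym : A^T = A.

Lemma char_poly_conj (F : fieldType) m (P D : 'M[F]_m) : P \in unitmx ->
  char_poly (invmx P *m D *m P) = char_poly D.
Proof.
move=> Pu; rewrite /char_poly /char_poly_mx.
have E : 'X%:M - map_mx polyC (invmx P *m D *m P) =
    map_mx polyC (invmx P) *m ('X%:M - map_mx polyC D) *m map_mx polyC P.
  rewrite mulmxBr mulmxBl !map_mxM; congr (_ - _).
  by rewrite scalar_mxC -mulmxA -map_mxM mulVmx // map_mx1 mulmx1.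
rewrite E !det_mulmx mulrAC -det_mulmx -map_mxM mulVmx // map_mx1 det1 mul1r //.
Qed.

(** The Hermitian spectral theorem is applied over [R[i]]. The diagonal is real, and the rows of the
    unitary matrix [P] at the indices with value [x] are independent eigenvectors. *)
Lemma symmetric_spectrum : exists d : seq R, [/\ size d = n,
  char_poly A = \prod_(x <- d) ('X - x%:P) &
  forall x, (count_mem x d <= \rank (eigenspace A x))%N].
Proof.
pose f : {rmorphism R -> R[i]} := real_complex R.
pose B := map_mx f A.
have Bherm : B \is hermsymmx.
  apply/is_hermitianmxP; rewrite expr0 scale1r; apply/matrixP => i j.
  by rewrite !mxE -[in LHS]A_sym mxE [RHS]conjc_real.
pose P := spectralmx B; pose D := spectral_diag B.
have Pu : P \in unitmx by apply: spectral_unit.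
have BE : B = invmx P *m diag_mx D *m P.
  by apply/orthomx_spectralP/hermitian_normalmx.
pose d i := complex.Re (D 0 i).
have Dd i : D 0 i = f (d i).
  have /mxOverP/(_ 0 i)/RRe_real := hermitian_spectral_diag_real Bherm.
  by move=> <-.
exists (map d (enum 'I_n)); split; first by rewrite size_map size_enum_ord.
  apply: (map_poly_inj f); rewrite rmorph_prod /= map_char_poly -/B BE char_poly_conj //.
  rewrite char_poly_trig ?diag_mx_is_trig // big_map big_enum.
  apply: eq_bigr => i _; rewrite !mxE eqxx mulr1n Dd.
  by rewrite map_polyXsubC.
move=> x; set I := [set i | d i == x].
have -> : count_mem x (map d (enum 'I_n)) = #|I|.
  rewrite count_map -sum1_count -sum1_card big_enum_cond /=.
  by apply: eq_bigl => i; rewrite inE.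
rewrite -(mxrank_map f) map_eigenspace -/B.
rewrite -(rank_supp R[i] I) -(mxrankMfree (supp R[i] I) (_ : row_free P)) ?row_free_unit //.
apply: mxrankS; apply/eigenspaceP; rewrite BE !mulmxA mulmxK //.
rewrite scalemxAl; congr (_ *m P); apply/row_matrixP => i.
rewrite row_mul; set z := row i _.
have zI : (z <= supp R[i] I)%MS by apply: row_sub.
rewrite linearZ /= -/z; apply/rowP => j; rewrite mul_mx_diag !mxE.
have [|jI] := boolP (j \in I).
  by rewrite inE => /eqP dx; rewrite Dd dx mulrC.
have := suppP zI j jI; rewrite !mxE => ->.
by rewrite mul0r mulr0.
Qed.

Definition eigensum (s : seq R) := (\sum_(i < size s) eigenspace A s`_i)%MS.

Lemma rank_eigensum s : uniq s ->
  \rank (eigensum s) = (\sum_(x <- s) \rank (eigenspace A x))%N.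
Proof.
move=> s_uniq; rewrite (big_nth 0) big_mkord; apply/mxdirectP/mxdirect_sum_eigenspace.
by move=> i j _ _ /eqP; rewrite nth_uniq // => /eqP/val_inj.
Qed.

(** Eigenvectors of a symmetric matrix for distinct eigenvalues are orthogonal, so the mixed terms
    vanish. *)
Lemma eigensumP s x : uniq s -> (x <= eigensum s)%MS -> exists y : 'I_(size s) -> 'rV[R]_n,
  x = \sum_i y i /\ form A x x = \sum_(i < size s) s`_i * (y i *m (y i)^T) 0 0.
Proof.
move=> s_uniq /sub_sumsmxP[u ->].
pose y i : 'rV[R]_n := u i *m eigenspace A s`_i; exists y; split => //.
have yA i : y i *m A = s`_i *: y i by apply/eigenspaceP; apply: submxMl.
have orth i j : i != j -> (y i *m (y j)^T) 0 0 = 0.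
  move=> ij; have E : y i *m A *m (y j)^T = y i *m (y j *m A)^T.
    by rewrite [(y j *m A)^T]trmx_mul A_sym mulmxA.
  move: E; rewrite !yA linearZ /= -scalemxAl -scalemxAr => /matrixP/(_ 0 0).
  rewrite [LHS]mxE [RHS]mxE => /eqP; rewrite -subr_eq0 -mulrBl mulf_eq0 subr_eq0.
  by rewrite nth_uniq // (inj_eq val_inj) (negPf ij) => /eqP.
rewrite /form mulmx_suml mulmx_suml summxE; apply: eq_bigr => i _.
rewrite -/(y i) yA linear_sum mulmx_sumr summxE (bigD1 i) //= big1 ?addr0.
  by rewrite -scalemxAl mxE.
by move=> j ji; rewrite -/(y j) -scalemxAl mxE orth ?mulr0 // eq_sym.
Qed.

Lemma dotmx_ge0 (y : 'rV[R]_n) : 0 <= (y *m y^T) 0 0.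
Proof. by rewrite mxE sumr_ge0 // => i _; rewrite mxE -expr2 sqr_ge0. Qed.

Lemma dotmx_eq0 (y : 'rV[R]_n) : (y *m y^T) 0 0 = 0 -> y = 0.
Proof.
rewrite mxE => /eqP; rewrite psumr_eq0 => [/allP y0|i _]; last first.
  by rewrite mxE -expr2 sqr_ge0.
apply/rowP => i; have := y0 i (mem_index_enum i).
by rewrite !mxE -expr2 sqrf_eq0 => /eqP ->.
Qed.

Lemma posdef_eigensum s : uniq s -> all (> 0) s -> posdef A (eigensum s).
Proof.
move=> s_uniq s_pos x xs; have [y [xy ->]] := eigensumP s_uniq xs; apply: contraNT.
have spos i : 0 < s`_(i : 'I_(size s)) by apply: (allP s_pos); apply: mem_nth.
rewrite -leNgt => le0; apply/eqP; rewrite xy big1 // => i _; apply: dotmx_eq0.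
have ge0 j : 0 <= s`_(j : 'I_(size s)) * (y j *m (y j)^T) 0 0.
  by rewrite mulr_ge0 ?dotmx_ge0 // ltW.
have : \sum_j s`_(j : 'I_(size s)) * (y j *m (y j)^T) 0 0 == 0.
  by rewrite eq_le le0 sumr_ge0.
rewrite psumr_eq0 // => /allP/(_ i (mem_index_enum i)).
by rewrite mulf_eq0 gt_eqF //= => /eqP.
Qed.

Lemma form_eigensum_ge0 s x : uniq s -> all (>= 0) s -> (x <= eigensum s)%MS ->
  0 <= form A x x.
Proof.
move=> s_uniq s_ge0 /(eigensumP s_uniq)[y [_ ->]]; apply: sumr_ge0 => i _.
by rewrite mulr_ge0 ?dotmx_ge0 //; apply: (allP s_ge0); apply: mem_nth.
Qed.

Local Notation p := (char_poly A).

Lemma rootsR_mup : (\sum_(x <- rootsR p) mup x p)%N = n /\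
  forall s, (\sum_(x <- s) mup x p <= \sum_(x <- s) \rank (eigenspace A x))%N.
Proof.
have [d [sd pd rk]] := symmetric_spectrum.
have mupE x : mup x p = count_mem x d by rewrite pd mu_prod_XsubC.
split; last by move=> s; apply: leq_sum => x _; rewrite mupE.
have p0 : p != 0 by rewrite monic_neq0 // char_poly_monic.
have E : rootsR p =i undup d.
  move=> x; have := roots_on_rootsR p0 x; rewrite in_itv /= mem_undup => <-.
  by rewrite pd root_prod_XsubC.
have rs : perm_eq (rootsR p) (undup d).
  by apply: uniq_perm; rewrite ?undup_uniq ?uniq_roots //.
rewrite (perm_big _ rs) /= (eq_bigr _ (fun x _ => mupE x)) -[RHS]sd.
rewrite -[RHS]sum1_size -[RHS]big_undup_iterop_count; apply: eq_bigr => x _.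
by rewrite Monoid.iteropE iter_addn_0 mul1n.
Qed.

Lemma npos_ge_char_poly :
  npos_ge A setT (\sum_(x <- rootsR p | (0 < x)%R) mup x p)%N.
Proof.
have [_ rk] := rootsR_mup.
exists (eigensum [seq x <- rootsR p | 0 < x]).
have s_uniq : uniq [seq x <- rootsR p | 0 < x] by rewrite filter_uniq // uniq_roots.
split.
- by apply/row_subP => i; apply/suppP => j; rewrite inE.
- rewrite -big_filter rank_eigensum //; apply: rk.
- by apply: posdef_eigensum => //; apply: filter_all.
Qed.

(** A negative definite subspace meets the sum of the eigenspaces of nonnegative eigenvalues only in
    0, and that sum has dimension at least [n] minus the right-hand side. *)
Lemma nneg_ge_char_poly q : nneg_ge A setT q ->
  (q <= \sum_(x <- rootsR p | (x < 0)%R) mup x p)%N.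
Proof.
have [tot rk] := rootsR_mup => -[U [_ qU Uneg]].
have s_uniq : uniq [seq x <- rootsR p | ~~ (x < 0)] by rewrite filter_uniq // uniq_roots.
have full m (M : 'M[R]_(m, n)) : (M <= supp R setT)%MS.
  by apply/row_subP => i; apply/suppP => j; rewrite inE.
have H := posdef_nonpos_rank (full _ U) (full _ (eigensum _)) Uneg.
have {}H : (\rank U +
    \sum_(x <- [seq x <- rootsR p | ~~ (x < 0)%R]) \rank (eigenspace A x) <= n)%N.
  rewrite -rank_eigensum // -[X in (_ <= X)%N]card_ord -cardsT; apply: H => x xs.
  rewrite formN oppr_le0; apply: form_eigensum_ge0 xs => //.
  by apply: sub_all (filter_all _ _) => z; rewrite -leNgt.
have := rk [seq x <- rootsR p | ~~ (x < 0)]; rewrite [X in (X <= _)%N]big_filter => rk'.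
rewrite (bigID (fun x => x < 0)) /= in tot.
rewrite -(leq_add2r (\sum_(x <- rootsR p | ~~ (x < 0)%R) mup x p)%N) tot.
by apply: leq_trans H; apply: leq_add.
Qed.
End RealSymmetric.

(** * Few negative eigenvalues *)

Section Family.
Variables (R : realFieldType) (n : nat) (A : 'M[R]_n).
Hypothesis A_sym : A^T = A.
Implicit Types (W : {set 'I_n}) (z : 'rV[R]_n).
Local Notation B := (form A).

(* The last condition makes the family free. *)
Fixpoint nonpos_family W (zs : seq 'rV[R]_n) : Prop :=
  if zs is z :: zs' then
    [/\ (z <= supp R W)%MS, B z z <= 0, {in zs', forall y, B y z = 0},
        exists2 j, z 0 j != 0 & {in zs', forall y : 'rV_n, y 0 j = 0}
      & nonpos_family W zs']
  else True.

Fixpoint span (zs : seq 'rV[R]_n) : 'M[R]_n :=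
  if zs is z :: zs' then (<<z>> + span zs')%MS else 0.

Lemma span_ker zs (M : 'cV[R]_n) : {in zs, forall y, y *m M = 0} -> span zs *m M = 0.
Proof.
move=> zsM; apply/eqP; rewrite -sub_kermx; elim: zs zsM => [|z zs IH] zsM /=.
  exact: sub0mx.
rewrite addsmx_sub genmxE sub_kermx zsM ?mem_head // eqxx IH // => y yzs.
by apply: zsM; rewrite inE yzs orbT.
Qed.

(** By orthogonality the form is nonpositive on the whole span, which has dimension [size zs] and so
    meets a positive definite subspace only in 0. *)
Lemma nonpos_family_card W p zs : npos_ge A W p -> nonpos_family W zs ->
  (p + size zs <= #|W|)%N.
Proof.
case=> U [UW pU Upos] fam.
suff [LW rL Lnonpos] : [/\ (span zs <= supp R W)%MS, \rank (span zs) = size zs &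
    forall x, (x <= span zs)%MS -> B x x <= 0].
  by rewrite -rL; apply: leq_trans (posdef_nonpos_rank UW LW Upos Lnonpos); rewrite leq_add2r.
elim: zs fam => [_|z zs IH] /=.
  split; rewrite ?sub0mx ?mxrank0 // => x; rewrite submx0 => /eqP ->.
  by rewrite form0l.
case=> zW zz orth [j zj wit] /IH[LW rL Lnonpos].
have Lz x : (x <= span zs)%MS -> B x z = 0.
  move=> /submxP[y ->]; rewrite /form -!mulmxA.
  rewrite (span_ker (M := A *m z^T)) ?mulmx0 ?mxE // => t /orth tz.
  by rewrite mulmxA [_ *m z^T]mx11_scalar -/(form A t z) tz raddf0.
have Lj x : (x <= span zs)%MS -> x 0 j = 0.
  move=> /submxP[y ->].
  have := span_ker (zs := zs) (M := delta_mx j 0); rewrite -colE => /(_ _)/matrixP Lj.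
  rewrite mxE big1 // => i _; have := Lj _ i 0; rewrite !mxE => -> //; first by rewrite mulr0.
  by move=> t /wit tj; rewrite -colE; apply/matrixP => a b; rewrite !ord1 !mxE.
split.
- by rewrite addsmx_sub genmxE zW.
- rewrite mxrank_disjoint_sum ?mxrank_gen ?rL; last first.
    apply/eqP/rowV0P => x; rewrite sub_capmx genmxE => /andP[/sub_rVP[a ->] /Lj].
    by rewrite mxE => /eqP; rewrite mulf_eq0 (negPf zj) orbF => /eqP ->; rewrite scale0r.
  rewrite rank_rV; suff -> : z != 0 by [].
  by apply: contraNneq zj => ->; rewrite mxE.
move=> x /sub_addsmxP[[a b] /= ->].
have /sub_rVP[c ->] : (a *m <<z>> <= z)%MS by rewrite -(genmxE z) submxMl.
set y := b *m _; have yL : (y <= span zs)%MS by rewrite submxMl.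
rewrite formDl !formDr !formZl !formZr (form_sym A_sym z y) (Lz y yL).
have := Lnonpos y yL; have := mulr_ge0 (sqr_ge0 c) (_ : 0 <= - B z z).
by rewrite oppr_ge0 zz expr2 => /(_ isT); lra.
Qed.
End Family.

(** * Critical vertex sets *)

Section Graph.
Variables (R : realFieldType) (n : nat) (e : rel 'I_n).
Hypotheses (e_sym : symmetric e) (e_irr : irreflexive e).
Implicit Types (W : {set 'I_n}).

Definition adj : 'M[R]_n := \matrix_(i, j) (e i j)%:R.
Local Notation "''e_' i" := (unitv R i) (at level 8, i at level 2, format "''e_' i").

Lemma adj_sym : adj^T = adj.
Proof. by apply/matrixP => i j; rewrite !mxE e_sym. Qed.

Lemma form_adj i j : form adj 'e_i 'e_j = (e i j)%:R.
Proof. by rewrite form_unitv mxE. Qed.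

Definition formE := (formDl, formDr, formNl, formNr, formZl, formZr, form_adj).

Definition degree_in W v := #|nbrs e v :&: W|.

(** Quantifying over [W] makes the bound available for the subgraph left after deleting a
    neighbourhood. *)
Definition bounded k m := forall W, ~ nneg_ge adj W k.+1 -> ~ npos_ge adj W m.+1.

(** A single edge gives a negative vector, by [nneg_ge_nbr] with [W'] empty; without edges the form
    is zero. *)
Lemma bounded00 : bounded 0 0.
Proof.
move=> W noneg [U [UW U1 Upos]]; apply: noneg.
have [z zU z0] : exists2 z : 'rV[R]_n, (z <= U)%MS & z != 0.
  by apply/rowV0Pn; rewrite -mxrank_eq0 -lt0n.
have [/existsP[u /existsP[v /and3P[uW vW uv]]]|noedge] :=
    boolP [exists u, exists v, [&& u \in W, v \in W & e u v]].
  apply: (@nneg_ge_nbr _ _ _ adj_sym W set0 u v 0) => //; try by rewrite mxE ?e_irr ?uv.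
  - exact: sub0set.
  - by move=> w; rewrite inE.
  - exact: npos_ge0.
have := Upos z zU z0; suff -> : form adj z z = 0 by rewrite ltxx.
have /suppP zW := submx_trans zU UW.
rewrite /form mxE big1 // => j _; rewrite mxE big_distrl big1 // => i _ /=.
rewrite !mxE.
have [iW|/zW ->] := boolP (i \in W); last by rewrite !mul0r.
have [jW|/zW ->] := boolP (j \in W); last by rewrite !mulr0.
have -> : e i j = false; last by rewrite mulr0 mul0r.
by apply: contraNF noedge => ij; apply/existsP; exists i; apply/existsP; exists j; rewrite iW jW.
Qed.

(** On a tight [W'] the dimensions of the two definite subspaces add up to |W'|. A negative part of
    dimension at most [k] would bring [W'] under the bound [m']; deleting the neighbours of [v] does
    so too, whence the degree condition. *)
Lemma critical_set k m m' W : bounded k m' -> (m' <= m)%N ->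
  ~ nneg_ge adj W k.+2 -> npos_ge adj W m.+1 ->
  exists W', [/\ #|W'| = (m.+1 + k.+1)%N, npos_ge adj W' m.+1 &
    {in W', forall v, (m.+1 <= degree_in W' v + m')%N}].
Proof.
move=> bk m'm noneg /(npos_ge_tight adj_sym)[W' [W'W W'pos W'neg]].
exists W'; have noneg' : ~ nneg_ge adj W' k.+2.
  by apply: contra_not noneg; apply: npos_ge_sub.
have cW' : #|W'| = (m.+1 + k.+1)%N.
  have le : (#|W'| - m.+1 <= k.+1)%N.
    by rewrite leqNgt; apply/negP => lt; apply: noneg'; apply: npos_ge_le W'neg.
  have := npos_ge_card W'pos.
  have [le'|gt'] := leqP (#|W'| - m.+1) k; last by lia.
  have : ~ nneg_ge adj W' k.+1.
    case: W'pos => U [UW pU Upos] [L [LW qL Lneg]].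
    have : (\rank U + \rank L <= #|W'|)%N.
      apply: (posdef_nonpos_rank UW LW Upos) => x xL.
      have [->|x0] := eqVneq x 0; first by rewrite form0l.
      by have := Lneg x xL x0; rewrite formN oppr_gt0 => /ltW.
    by move: pU qL le'; move: (\rank U) (\rank L) => a b; lia.
  by move/bk; case; apply: npos_ge_le W'pos.
split=> // v vW'; set D := nbrs e v :&: W'.
have [D0|/set0Pn[u]] := eqVneq D set0; last first.
  rewrite in_setI mem_nbrs => /andP[vu uW'].
  have : ~ nneg_ge adj (W' :\: D) k.+1.
    move=> H; apply: noneg'; move: H.
    apply: (@nneg_ge_nbr _ _ _ adj_sym W' _ u v) => //; try by rewrite mxE ?e_irr // e_sym vu.
    - exact: subsetDl.
    - move=> w; rewrite in_setD in_setI mem_nbrs => /andP[+ wW'].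
      by rewrite wW' andbT mxE e_sym => /negPf ->.
  move/bk; rewrite /degree_in -/D leqNgt => npos'; apply/negP => lt; apply: npos'.
  have := npos_ge_setD D W'pos; have -> : W' :&: D = D by rewrite /D setIC -setIA setIid.
  by apply: npos_ge_le; rewrite ltn_subRL.
(* Here [v] is isolated in [W']: ['e_v] has square 0, is orthogonal to [L] and outside it, so
   [L + 'e_v] is nonpositive and one dimension too large. *)
exfalso; case: W'pos W'neg => U [UW pU Upos] [L [LW qL Lneg]].
have Lv x : (x <= L)%MS -> form adj x 'e_v = 0.
  move=> /submx_trans/(_ LW)/suppP xW'; rewrite /form trmx_delta -colE !mxE.
  rewrite big1 // => w _; have [wW'|/xW'->] := boolP (w \in W'); last by rewrite mul0r.
  have : w \notin D by rewrite D0 inE.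
  by rewrite in_setI wW' andbT mem_nbrs mxE e_sym => /negPf ->; rewrite mulr0.
have := @posdef_nonpos_rank _ _ _ W' _ _ U (L + 'e_v)%MS UW _ Upos.
rewrite addsmx_sub LW unitv_supp // => /(_ isT).
rewrite mxrank_disjoint_sum; last first.
  apply/eqP/rowV0P => x; rewrite sub_capmx => /andP[xL /sub_rVP[c xc]].
  apply/eqP; apply: contraT => /(Lneg _ xL).
  by rewrite formN xc !formE e_irr !mulr0 oppr0 ltxx.
rewrite mxrank_delta => H; suff : (\rank U + (\rank L + 1) <= #|W'|)%N.
  by move: qL pU; rewrite cW'; move: (\rank U) (\rank L) => a b; lia.
apply: H => x /sub_addsmxP[[a b] /= ->].
have /sub_rVP[c ->] : (b *m 'e_v <= 'e_v)%MS by rewrite submxMl.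
set y := a *m L; have yL : (y <= L)%MS by rewrite submxMl.
rewrite !formE e_irr (form_sym adj_sym 'e_v) Lv // !mulr0 !addr0.
have [->|y0] := eqVneq y 0; first by rewrite form0l.
by have := Lneg y yL y0; rewrite formN oppr_gt0 => /ltW.
Qed.
End Graph.

Section Cases.
Variables (R : realFieldType) (n : nat) (e : rel 'I_n).
Hypotheses (e_sym : symmetric e) (e_irr : irreflexive e).
Implicit Types (W : {set 'I_n}).
Local Notation adj := (adj R e).
Local Notation "''e_' i" := (unitv R i) (at level 8, i at level 2, format "''e_' i").
Local Notation fam := (nonpos_family adj).

Lemma mader_degree W : ~ has_K5_minor e -> (2 < #|W|)%N ->
  (\sum_(v in W) degree_in e W v + 10 < 6 * #|W|)%N.
Proof.
move=> noK5 W3; rewrite ltnNge; apply/negP => le; apply: noK5.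
pose f x y := [&& x \in W, y \in W & e x y].
apply: (@has_K5_minor_sub _ f); first by move=> x y /and3P[].
apply: (@mader_K5_minor _ _ W) => //.
- by move=> x y; rewrite /f e_sym andbCA.
- by move=> x; rewrite /f e_irr !andbF.
- by move=> x y /and3P[].
apply: leq_trans le _; rewrite leq_add2r /arcs big_mkcond /=.
apply: leq_sum => x _; case: ifP => // xW; apply: subset_leq_card.
by apply/subsetP => y; rewrite in_setI !mem_nbrs /f xW => /andP[-> ->].
Qed.

Lemma bounded_step k m m' : ~ has_K5_minor e -> (m' + 5 <= m)%N ->
  bounded R e k m' -> bounded R e k.+1 m.
Proof.
move=> noK5 m'm bk W noneg Wpos.
have [|W' [cW' _ deg]] := critical_set e_sym e_irr bk _ noneg Wpos; first by lia.
have W3 : (2 < #|W'|)%N by rewrite cW'; lia.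
have := mader_degree noK5 W3; rewrite cW'.
have : (\sum_(v in W') 6 <= \sum_(v in W') degree_in e W' v)%N.
  by apply: leq_sum => v vW'; have := deg v vW'; lia.
by rewrite sum_nat_const cW'; lia.
Qed.

Definition independent (s : seq 'I_n) := {in s &, forall i j, ~~ e i j}.

Lemma fam_independent W s : uniq s -> {subset s <= W} -> independent s ->
  fam W (map (unitv R) s).
Proof.
elim: s => //= i s IH /andP[is_ s_uniq] sW ind.
have ei y : y \in s -> y != i by apply: contraTneq => ->.
split.
- by apply/unitv_supp/sW; rewrite mem_head.
- by rewrite form_adj e_irr.
- move=> _ /mapP[j js ->]; rewrite form_adj (negPf (ind j i _ _)) ?mem_head //.
  by rewrite inE js orbT.
- exists i; first by rewrite unitvE eqxx oner_eq0.
  by move=> _ /mapP[j js ->]; rewrite unitvE eq_sym (negPf (ei j js)).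
apply: IH => // [j js|j k js ks]; first by apply: sW; rewrite inE js orbT.
by apply: ind; rewrite inE ?js ?ks orbT.
Qed.

(* An independent set that does not separate [x] and [y] is orthogonal to
   [e_x - e_y]. *)
Lemma fam_twins W s x y : uniq s -> {subset s <= W} -> independent s ->
  x \in W -> y \in W -> x != y -> x \notin s -> {in s, forall i, e i x = e i y} ->
  fam W (('e_x - 'e_y) :: map (unitv R) s).
Proof.
move=> s_uniq sW ind xW yW xy xs twins /=; split.
- by rewrite addmx_sub ?eqmx_opp ?unitv_supp.
- by rewrite !formE // !e_irr (e_sym y x); case: (e x y) => /=; lra.
- by move=> _ /mapP[j js ->]; rewrite !formE // twins // subrr.
- exists x; first by rewrite !mxE !eqxx (negPf xy) /= subr0 oner_eq0.
  by move=> _ /mapP[j js ->]; rewrite unitvE; case: eqP => // xj; rewrite xj js in xs.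
exact: fam_independent.
Qed.

(** On a clique the adjacency matrix is J - 1, so the form is minus the dot product on vectors of
    coordinate sum 0, of which this is an orthogonal basis. *)
Lemma fam_clique3 W a b c : uniq [:: a; b; c] -> {subset [:: a; b; c] <= W} ->
  {in [:: a; b; c] &, forall i j, i != j -> e i j} ->
  fam W [:: 'e_a + 'e_b - 2 *: 'e_c; 'e_a - 'e_b].
Proof.
move=> u sW clq.
have [aI bI cI] : [/\ a \in [:: a; b; c], b \in [:: a; b; c] & c \in [:: a; b; c]].
  by rewrite !inE !eqxx !orbT.
move: u; rewrite /= !inE !negb_or => /and3P[/andP[ab ac] bc _].
have E i j : i \in [:: a; b; c] -> j \in [:: a; b; c] -> i != j ->
  (e i j = true) * (e j i = true) by move=> *; rewrite !clq // eq_sym.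
pose adjE := (E a b aI bI ab, E a c aI cI ac, E b c bI cI bc, e_irr).
have nE (i j : 'I_n) : i != j -> ((i == j) = false) * ((j == i) = false).
  by move=> ij; split; [|rewrite eq_sym]; exact: negbTE.
have neqE := (nE _ _ ab, nE _ _ ac, nE _ _ bc).
rewrite /=; split.
- by rewrite ?(addmx_sub, eqmx_opp, scalemx_sub, unitv_supp) ?sW.
- by rewrite !formE // !adjE /=; lra.
- by move=> y; rewrite !inE => /eqP ->; rewrite !formE // !adjE /=; lra.
- exists c; first by rewrite !mxE !eqxx !neqE /=; apply/eqP; lra.
  by move=> y; rewrite !inE => /eqP ->; rewrite !mxE !eqxx !neqE /=; lra.
split => //.
- by rewrite ?(addmx_sub, eqmx_opp, scalemx_sub, unitv_supp) ?sW.
- by rewrite !formE // !adjE /=; lra.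
- by exists b => //; rewrite !mxE !eqxx !neqE /=; apply/eqP; lra.
Qed.

Lemma fam_clique4 W a b c d : uniq [:: a; b; c; d] -> {subset [:: a; b; c; d] <= W} ->
  {in [:: a; b; c; d] &, forall i j, i != j -> e i j} ->
  fam W [:: 'e_a + 'e_b + 'e_c - 3 *: 'e_d; 'e_a + 'e_b - 2 *: 'e_c; 'e_a - 'e_b].
Proof.
move=> u sW clq.
have sub : {subset [:: a; b; c] <= [:: a; b; c; d]}.
  by move=> i; rewrite !inE => /or3P[]->; rewrite ?orbT.
have fam3 : fam W [:: 'e_a + 'e_b - 2 *: 'e_c; 'e_a - 'e_b].
  apply: fam_clique3 => [|i /sub/sW //|i j /sub iI /sub jI]; last exact: clq.
  by move: u; rewrite -[[:: a; b; c; d]]/(rcons [:: a; b; c] d) rcons_uniq => /andP[].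
have [aI bI cI dI] : [/\ a \in [:: a; b; c; d], b \in [:: a; b; c; d],
    c \in [:: a; b; c; d] & d \in [:: a; b; c; d]] by rewrite !inE !eqxx !orbT.
move: u; rewrite /= !inE !negb_or => /and4P[/and3P[ab ac ad] /andP[bc bd] cd _].
have E i j : i \in [:: a; b; c; d] -> j \in [:: a; b; c; d] -> i != j ->
  (e i j = true) * (e j i = true) by move=> *; rewrite !clq // eq_sym.
pose adjE := (E a b aI bI ab, E a c aI cI ac, E a d aI dI ad, E b c bI cI bc, E b d bI dI bd,
  E c d cI dI cd, e_irr).
have nE (i j : 'I_n) : i != j -> (j == i) = false.
  by move=> ij; rewrite eq_sym; exact: negbTE.
have neqE := (nE _ _ ad, nE _ _ bd, nE _ _ cd).
split; last exact: fam3.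
- by rewrite ?(addmx_sub, eqmx_opp, scalemx_sub, unitv_supp) ?sW.
- by rewrite !formE // !adjE /=; lra.
- by move=> y; rewrite !inE => /orP[]/eqP ->; rewrite !formE // !adjE /=; lra.
- exists d; first by rewrite !mxE !eqxx !neqE /=; apply/eqP; lra.
  by move=> y; rewrite !inE => /orP[]/eqP ->; rewrite !mxE !eqxx !neqE /=; lra.
Qed.

Lemma degree_inE W v : degree_in e W v = (\sum_(x in W) e v x)%N.
Proof.
rewrite /degree_in -sum1_card [LHS]big_mkcond [RHS]big_mkcond /=; apply: eq_bigr => x _.
by rewrite in_setI mem_nbrs; case: (e v x); case: (x \in W).
Qed.

Lemma full_degree W u v : v \in W -> (#|W| <= (degree_in e W v).+1)%N ->
  u \in W -> u != v -> e v u.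
Proof.
move=> vW; rewrite (cardsD1 v W) vW ltnS => le uW uv.
have sub : nbrs e v :&: W \subset W :\ v.
  apply/subsetP => x; rewrite in_setI in_setD1 mem_nbrs => /andP[vx ->].
  by rewrite andbT; apply: contraTneq vx => ->; rewrite e_irr.
have /eqP E : nbrs e v :&: W == W :\ v by rewrite eqEcard sub.
by have := in_setD1 u W v; rewrite -E uv uW in_setI mem_nbrs uW andbT.
Qed.

Lemma clique_or_independent (S : {set 'I_n}) k : (k <= #|S|)%N ->
  (exists s, [/\ uniq s, size s = k, {subset s <= S} &
     {in s &, forall i j, i != j -> e i j}]) \/
  (exists s t, [/\ s \in S, t \in S, s != t & ~~ e s t]).
Proof.
move=> kS; have [/existsP[s /existsP[t /and4P[? ? ? ?]]]|clq] :=
  boolP [exists s, exists t, [&& s \in S, t \in S, s != t & ~~ e s t]].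
  by right; exists s, t.
left; exists (take k (enum S)); split.
- by rewrite take_uniq ?enum_uniq.
- by rewrite size_takel // -cardE.
- by move=> i /mem_take; rewrite mem_enum.
move=> i j /mem_take + /mem_take; rewrite !mem_enum => iS jS ij.
by apply: contraNT clq => eij; apply/existsP; exists i; apply/existsP; exists j; apply/and4P.
Qed.

(** The independent set [s] already attains the maximal size [k] of a nonpositive family;
    [fam_twins] would add a vector. *)
Lemma independent_traces_inj W p k (s : seq 'I_n) : npos_ge adj W p -> #|W| = (p + k)%N ->
  size s = k -> uniq s -> {subset s <= W} -> independent s ->
  {in W :\: [set:: s] &, forall x y, {in s, forall i, e i x = e i y} -> x = y}.
Proof.
move=> Wp cW sk s_uniq sW ind x y; rewrite !inE => /andP[xs xW] /andP[ys yW] tw.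
apply/eqP; apply: contraT => xy.
have := nonpos_family_card (adj_sym R e_sym) Wp (fam_twins s_uniq sW ind xW yW xy xs tw).
by rewrite /= size_map sk cW addnS ltnn.
Qed.

(** A critical set has 3 vertices of degree at least 2. It is a triangle, which carries two
    orthogonal negative vectors where only one is allowed. *)
Lemma bounded11 : bounded R e 1 1.
Proof.
move=> W noneg Wpos.
have [//|W' [cW' W'pos deg]] := critical_set e_sym e_irr (bounded00 e_sym e_irr) _ noneg Wpos.
have [[s [us ss sW clq]]|[s [t [sW tW st nst]]]] := clique_or_independent (eq_leq (esym cW')).
  case: s us ss sW clq => [|a [|b [|c [|]]]] //= us _ sW clq.
  by have := nonpos_family_card (adj_sym R e_sym) W'pos (fam_clique3 us sW clq); rewrite cW'.
suff : e s t by rewrite (negPf nst).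
by apply: (full_degree sW _ tW); rewrite 1?eq_sym // cW'; have := deg s sW; lia.
Qed.

(** A critical set has 6 vertices of degree at least 3. A K4 carries three orthogonal vectors, one
    too many, so some [s] and [t] are not adjacent. The other four vertices have distinct traces on
    them, so the degrees of [s] and [t] add up to at most 0 + 1 + 1 + 2 = 4. *)
Lemma bounded23 : bounded R e 2 3.
Proof.
move=> W noneg Wpos.
have [//|W' [cW' W'pos deg]] := critical_set e_sym e_irr bounded11 _ noneg Wpos.
have c4 : (4 <= #|W'|)%N by rewrite cW'.
have [[s [us ss sW clq]]|[s [t [sW tW st nst]]]] := clique_or_independent c4.
  case: s us ss sW clq => [|a [|b [|c [|d [|]]]]] //= us _ sW clq.
  by have := nonpos_family_card (adj_sym R e_sym) W'pos (fam_clique4 us sW clq); rewrite cW'.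
have ind : independent [:: s; t].
  by move=> i j; rewrite !inE => /orP[]/eqP-> /orP[]/eqP->; rewrite ?e_irr // e_sym.
have stW : {subset [:: s; t] <= W'} by move=> i; rewrite !inE => /orP[]/eqP->.
have ust : uniq [:: s; t] by rewrite /= inE st.
have inj := independent_traces_inj W'pos cW' (erefl (size [:: s; t])) ust stW ind.
pose tr x := (e s x, e t x).
have tr_inj : {in W' :\: [set:: [:: s; t]] &, injective tr}.
  move=> x y xW yW [sx tx]; apply: inj => // i; rewrite !inE => /orP[]/eqP-> //.
have : (degree_in e W' s + degree_in e W' t <= 4)%N.
  rewrite !degree_inE -big_split /= (big_setID [set:: [:: s; t]]) /=.
  rewrite big1 ?add0n => [|x]; last first.
    by rewrite !inE => /andP[_ /orP[]/eqP->]; rewrite !e_irr ?(negPf nst) // e_sym (negPf nst).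
  pose f (b : bool * bool) : nat := (b.1 + b.2)%N.
  have -> : (\sum_(x in W' :\: [set:: [:: s; t]]) (e s x + e t x) =
      \sum_(b in tr @: (W' :\: [set:: [:: s; t]])) f b)%N.
    exact: (esym (big_imset f tr_inj)).
  apply: (@leq_trans (\sum_b f b)%N).
    by rewrite [leqRHS](bigID (mem (tr @: (W' :\: [set:: [:: s; t]])))) leq_addr.
  by rewrite -(pair_bigA _ (fun a b : bool => a + b)%N) /= !big_bool.
by have := deg s sW; have := deg t tW; lia.
Qed.
End Cases.

(** * Critical sets of nine vertices *)

Section Nine.
Variables (R : realFieldType) (n : nat) (e : rel 'I_n).
Hypotheses (e_sym : symmetric e) (e_irr : irreflexive e).
Local Notation adj := (adj R e).
Local Notation "''e_' i" := (unitv R i) (at level 8, i at level 2, format "''e_' i").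
Local Notation fam := (nonpos_family adj).

Lemma fam_cone (W : {set 'I_n}) w zs : w \in W ->
  {in zs, forall y : 'rV_n, form adj y 'e_w = 0 /\ y 0 w = 0} ->
  fam W zs -> fam W ('e_w :: zs).
Proof.
move=> wW zsw famz; split=> //.
- exact: unitv_supp.
- by rewrite form_adj e_irr.
- by move=> y /zsw[].
- by exists w => [|y /zsw[]//]; rewrite unitvE eqxx oner_eq0.
Qed.

Variable W : {set 'I_n}.
Hypotheses (cW : #|W| = (6 + 3)%N) (Wpos : npos_ge adj W 6).
Hypothesis deg3 : {in W, forall v, (2 < degree_in e W v)%N}.

Lemma fam_size zs : fam W zs -> (size zs <= 3)%N.
Proof. by move/(nonpos_family_card (adj_sym R e_sym) Wpos); rewrite cW leq_add2l. Qed.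

Lemma no_clique4_cone w a b c d : w \in W -> uniq [:: a; b; c; d] ->
  {subset [:: a; b; c; d] <= W} ->
  {in [:: a; b; c; d] &, forall i j, i != j -> e i j} ->
  {in [:: a; b; c; d], forall i, i != w /\ ~~ e w i} -> False.
Proof.
move=> wW us sW clq nw.
have wN i : i \in [:: a; b; c; d] -> (e i w = false) * ((w == i) = false).
  by move=> /nw[iw wi]; split; [rewrite e_sym; apply/negbTE|rewrite eq_sym; apply/negbTE].
have [wa wb wc wd] : [/\ (e a w = false) * ((w == a) = false),
   (e b w = false) * ((w == b) = false), (e c w = false) * ((w == c) = false)
   & (e d w = false) * ((w == d) = false)].
  by split; apply: wN; rewrite !inE eqxx ?orbT.
have famK := fam_clique4 R e_irr us sW clq.
suff orth : {in [:: 'e_a + 'e_b + 'e_c - 3 *: 'e_d; 'e_a + 'e_b - 2 *: 'e_c; 'e_a - 'e_b],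
    forall y : 'rV_n, form adj y 'e_w = 0 /\ y 0 w = 0}.
  by have := fam_size (fam_cone wW orth famK).
move=> y; rewrite !inE => /or3P[]/eqP->; rewrite !formE // ?wa ?wb ?wc ?wd !mxE ?eqxx
  ?wa ?wb ?wc ?wd /=; split; lra.
Qed.

Lemma triple_independent s t w : ~~ e s t -> ~~ e s w -> ~~ e t w ->
  independent e [:: s; t; w].
Proof.
move=> st sw tw i j; rewrite !inE => /or3P[]/eqP-> /or3P[]/eqP->;
  by rewrite ?e_irr // e_sym.
Qed.

(** The six other vertices have distinct traces in {0, 1}^3. All eight traces have total weight 12,
    and at least one of the two that do not occur is nonzero. *)
Lemma triple_degree_sum s t w : uniq [:: s; t; w] -> {subset [:: s; t; w] <= W} ->
  independent e [:: s; t; w] ->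
  (degree_in e W s + degree_in e W t + degree_in e W w <= 11)%N.
Proof.
move=> u sub ind; set I := [set:: [:: s; t; w]].
have inj := independent_traces_inj e_sym e_irr Wpos cW (erefl (size [:: s; t; w])) u sub ind.
pose tr x := (e s x, e t x, e w x).
have tr_inj : {in W :\: I &, injective tr}.
  move=> x y xW yW [sx tx wx]; apply: inj => // i.
  by rewrite !inE => /or3P[]/eqP->.
pose f (b : bool * bool * bool) : nat := (b.1.1 + b.1.2 + b.2)%N.
have -> : (degree_in e W s + degree_in e W t + degree_in e W w =
    \sum_(b in tr @: (W :\: I)) f b)%N.
  rewrite !degree_inE -!big_split /= (big_setID I) /=.
  rewrite big1 ?add0n => [|x].
    exact: (esym (big_imset f tr_inj)).
  rewrite in_setI !inE => /andP[_ xI].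
  have N i : i \in [:: s; t; w] -> e i x = false.
    by move=> iI; apply/negbTE/ind => //; rewrite !inE.
  by rewrite !N ?inE ?eqxx ?orbT.
set T := tr @: _.
have cT : #|T| = 6%N.
  rewrite card_in_imset //.
  have cI : #|I| = 3%N by rewrite /I cardsE; move/card_uniqP: u.
  have IW : I \subset W by apply/subsetP => i; rewrite inE; apply: sub.
  by rewrite cardsD (setIidPr IW) cI cW.
have tot : (\sum_(b in T) f b + \sum_(b in ~: T) f b = 12)%N.
  have -> : (12 = \sum_b f b)%N.
    have E := pair_bigA addn (fun (a : bool * bool) (c : bool) => f (a, c)).
    rewrite -[RHS]E -(pair_bigA _ (fun a b : bool => \sum_c f (a, b, c))%N) /=.
    by rewrite !big_bool.
  rewrite [RHS](bigID (mem T)) /=; congr (_ + _)%N.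
  by apply: eq_bigl => b; rewrite !inE.
have [b bT fb] : exists2 b, b \in ~: T & (0 < f b)%N.
  have : (1 < #|~: T|)%N.
    by have := cardsC T; rewrite cT !card_prod card_bool; lia.
  case/card_gt1P => b [c [bT cT' bc]].
  have [b0|] := posnP (f b); last by exists b.
  have [c0|] := posnP (f c); last by exists c.
  by move: b c b0 c0 bc {bT cT'} => [[[] []] []] [[[] []] []].
by move: tot; rewrite [X in (_ + X)%N](bigD1 b) //=; lia.
Qed.

(** Otherwise all degrees are at least 4, and Mader's bound, with degree sum below 44, gives [w] of
    degree 4. Its four non-neighbours do not form a K4, so two of them form an independent triple
    with [w], of degree sum at least 12. *)
Lemma exists_cubic : ~ has_K5_minor e -> exists2 w, w \in W & degree_in e W w = 3%N.
Proof.
move=> noK5.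
suff /exists_inP[w wW /eqP dw] : [exists (w | w \in W), degree_in e W w == 3%N] by exists w.
apply: contraT => /exists_inPn no3.
have deg4 : {in W, forall v, (3 < degree_in e W v)%N}.
  by move=> v vW; have := deg3 vW; have := no3 v vW; rewrite leq_eqVlt eq_sym; case: eqP => // ->.
have W3 : (2 < #|W|)%N by rewrite cW.
have [w wW dw] : exists2 w, w \in W & (degree_in e W w < 5)%N.
  apply/exists_inP; apply: contraT => /exists_inPn deg.
  have : (\sum_(v in W) 5 <= \sum_(v in W) degree_in e W v)%N.
    by apply: leq_sum => v /deg; rewrite -leqNgt.
  by have := mader_degree e_sym e_irr noK5 W3; rewrite sum_nat_const cW; lia.
pose M := W :\: nbrs e w :\ w.
have cM : (4 <= #|M|)%N.
  have c1 : #|W :\: nbrs e w| = (9 - degree_in e W w)%N by rewrite cardsD cW /degree_in setIC.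
  have E : (9 - degree_in e W w = 1 + #|M|)%N.
    by rewrite -c1 (cardsD1 w) in_setD mem_nbrs e_irr wW.
  by rewrite -(leq_add2l 1) -E; lia.
have MP i : i \in M -> [/\ i \in W, i != w & ~~ e w i].
  by rewrite !inE => /and3P[-> -> ->].
have [[s [us ss sM clq]]|[s [t [sM tM st nst]]]] := clique_or_independent e cM.
  case: s us ss sM clq => [|a [|b [|c [|d [|]]]]] //= us _ sM clq.
  by case: (no_clique4_cone wW us _ clq) => i /sM/MP[].
have [sW sw ws] := MP s sM; have [tW tw wt] := MP t tM.
have ind : independent e [:: s; t; w].
  by apply: triple_independent => //; rewrite e_sym.
have := @triple_degree_sum s t w; rewrite /= !inE negb_or st sw tw => /(_ isT _ ind).
have := deg4 s sW; have := deg4 t tW; have := deg4 w wW => d1 d2 d3 /(_ _)H.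
have : {subset [:: s; t; w] <= W} by move=> i; rewrite !inE => /or3P[]/eqP->.
by move/H; rewrite leqNgt => /negP[]; apply: leq_add (leq_add d3 d2) d1.
Qed.
End Nine.

(** * The non-neighbours of a cubic vertex *)

Section Pentagon.
Variables (R : realFieldType) (n : nat) (e : rel 'I_n).
Hypotheses (e_sym : symmetric e) (e_irr : irreflexive e).
Local Notation adj := (adj R e).
Local Notation "''e_' i" := (unitv R i) (at level 8, i at level 2, format "''e_' i").
Local Notation fam := (nonpos_family adj).
Variable W : {set 'I_n}.

(** Let [u] be ['e_x - 'e_y] made orthogonal to the pentagon by subtracting C^-1 d. Its square is -2
    [x ~ y] - d^T C^-1 d. If this were nonpositive, [u] together with the independent vertices [w],
    [c0] and [c2] would form a family of size 4; [u] is orthogonal to [w] because [x] and [y] are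
    both adjacent to [w]. *)
Lemma pentagon_form_lt0 (c0 c1 c2 c3 c4 w x y : 'I_n) :
  (forall zs, fam W zs -> size zs <= 3)%N ->
  {subset [:: c0; c1; c2; c3; c4; w; x; y] <= W} -> uniq [:: c0; c1; c2; c3; c4] ->
  [&& e c0 c1, e c1 c2, e c2 c3, e c3 c4 & e c0 c4] ->
  ~~ [|| e c0 c2, e c0 c3, e c1 c3, e c1 c4 | e c2 c4] ->
  {in [:: c0; c1; c2; c3; c4], forall c, c != w /\ ~~ e w c} ->
  e w x -> e w y -> x != y ->
  C5_form [seq e x c | c <- [:: c0; c1; c2; c3; c4]]
          [seq e y c | c <- [:: c0; c1; c2; c3; c4]] < 0.
Proof.
move=> fam3 sW cu /and5P[c01 c12 c23 c34 c04] nadj cw wx wy xy.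
move: nadj; rewrite !negb_or => /and5P[/negPf c02 /negPf c03 /negPf c13 /negPf c14 /negPf c24].
have [w0 w1 w2 w3 w4] : [/\ e w c0 = false, e w c1 = false, e w c2 = false, e w c3 = false
   & e w c4 = false].
  by split; apply/negbTE; apply: (cw _ _).2; rewrite !inE eqxx ?orbT.
have xc c : c \in [:: c0; c1; c2; c3; c4] -> (x == c) = false.
  by move=> cin; apply/negbTE; apply: contraTneq wx => ->; apply: (cw c cin).2.
rewrite ltNge; apply/negP => q_ge0.
pose d c : R := (e x c)%:R - (e y c)%:R.
pose s := d c0 + d c1 + d c2 + d c3 + d c4.
have qR : 0 <= 4 * (d c0 * d c1 + d c1 * d c2 + d c2 * d c3 + d c3 * d c4 + d c4 * d c0) +
   2 * (d c0 * d c0 + d c1 * d c1 + d c2 * d c2 + d c3 * d c3 + d c4 * d c4) - s * s.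
  by move: q_ge0; rewrite -(ler_int R) /C5_form /= !(intrD, intrM, mulrNz).
(* The entry of C^-1 d at [c], where [a] and [b] are the neighbours of [c] on the pentagon. *)
pose h c a b := d a + d b + d c - s / 2.
pose u : 'rV[R]_n := 'e_x - 'e_y - (h c0 c4 c1 *: 'e_c0 + h c1 c0 c2 *: 'e_c1 + h c2 c1 c3 *: 'e_c2
   + h c3 c2 c4 *: 'e_c3 + h c4 c3 c0 *: 'e_c4).
have adjE := (c01, c12, c23, c34, c04, c02, c03, c13, c14, c24,
  etrans (e_sym c1 c0) c01, etrans (e_sym c2 c1) c12, etrans (e_sym c3 c2) c23,
  etrans (e_sym c4 c3) c34, etrans (e_sym c4 c0) c04, etrans (e_sym c2 c0) c02,
  etrans (e_sym c3 c0) c03, etrans (e_sym c3 c1) c13, etrans (e_sym c4 c1) c14,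
  etrans (e_sym c4 c2) c24, e_irr).
have uc0 : form adj 'e_c0 u = 0.
  by rewrite /u !formE // !adjE !(e_sym c0) /h /s /d /=; lra.
have uc1 : form adj 'e_c1 u = 0.
  by rewrite /u !formE // !adjE !(e_sym c1) /h /s /d /=; lra.
have uc2 : form adj 'e_c2 u = 0.
  by rewrite /u !formE // !adjE !(e_sym c2) /h /s /d /=; lra.
have uc3 : form adj 'e_c3 u = 0.
  by rewrite /u !formE // !adjE !(e_sym c3) /h /s /d /=; lra.
have uc4 : form adj 'e_c4 u = 0.
  by rewrite /u !formE // !adjE !(e_sym c4) /h /s /d /=; lra.
have uw : form adj 'e_w u = 0.
  by rewrite /u !formE // wx wy w0 w1 w2 w3 w4 /=; lra.
have uu : form adj u u <= 0.
  have -> : form adj u u = form adj ('e_x - 'e_y) u.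
    rewrite {1}/u !(formDl, formNl, formZl) uc0 uc1 uc2 uc3 uc4.
    by rewrite !mulr0 !addr0 oppr0 addr0.
  have -> : form adj ('e_x - 'e_y) u = - 2 * (e x y)%:R - (h c0 c4 c1 * d c0 +
      h c1 c0 c2 * d c1 + h c2 c1 c3 * d c2 + h c3 c2 c4 * d c3 + h c4 c3 c0 * d c4).
    by rewrite /u !formE // !e_irr (e_sym y x) /d /=; ring.
  have : 0 <= (e x y)%:R :> R by apply: ler0n.
  by move: qR; rewrite /h /s; move: (d c0) (d c1) (d c2) (d c3) (d c4) => *; nra.
have ind : independent e [:: w; c0; c2].
  by move=> i j; rewrite !inE => /or3P[]/eqP-> /or3P[]/eqP->; rewrite ?e_irr // ?(e_sym _ w)
    ?w0 ?w2 ?adjE.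
suff /fam3 : fam W (u :: map (unitv R) [:: w; c0; c2]) by [].
split.
- have cW c : c \in [:: c0; c1; c2; c3; c4; w; x; y] -> ('e_c <= supp R W)%MS.
    by move=> cin; apply/unitv_supp/sW.
  by rewrite /u ?(addmx_sub, eqmx_opp, scalemx_sub) ?cW // !inE eqxx ?orbT.
- exact: uu.
- by move=> v; rewrite !inE => /or3P[]/eqP->.
- have wxn : (x == w) = false by apply: contraTF wx => /eqP ->; rewrite e_irr.
  exists x.
    rewrite /u !mxE !eqxx (negPf xy) !xc ?inE ?eqxx ?orbT //= !mulr0 !addr0 subr0 oppr0 addr0.
    exact: oner_neq0.
  by move=> v; rewrite !inE => /or3P[]/eqP->; rewrite unitvE ?wxn ?xc ?inE ?eqxx ?orbT.
apply: fam_independent => //.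
- rewrite /= !inE negb_or; move: cu; rewrite /= !inE !negb_or.
  case: (cw c0 (mem_head _ _)) => c0w _.
  case: (cw c2) => [|c2w _]; first by rewrite !inE eqxx !orbT.
  by rewrite ![w == _]eq_sym c0w c2w => /andP[/and4P[_ -> _ _] _].
- by move=> i; rewrite !inE => /or3P[]/eqP->; apply: sW; rewrite !inE eqxx ?orbT.
Qed.

(** The bowtie carries three orthogonal vectors of negative square: one difference for each
    triangle, and a symmetric vector of square -4. Together with [w] they form a family of size
    4. *)
Lemma no_bowtie (r s p t q w : 'I_n) :
  (forall zs, fam W zs -> size zs <= 3)%N ->
  {subset [:: r; s; p; t; q; w] <= W} -> uniq [:: r; s; p; t; q] ->
  [&& e r s, e r p, e s p, e r t, e r q & e t q] ->
  ~~ [|| e s t, e s q, e p t | e p q] ->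
  {in [:: r; s; p; t; q], forall c, c != w /\ ~~ e w c} -> False.
Proof.
move=> fam3 sW cu /and5P[rs rp sp rt /andP[rq tq]] nadj cw.
move: nadj; rewrite !negb_or => /and4P[/negPf st /negPf sq /negPf pt /negPf pq].
have wN c : c \in [:: r; s; p; t; q] -> (e c w = false) * ((w == c) = false).
  by move=> /cw[cw' wc]; rewrite e_sym eq_sym; split; apply/negbTE.
have [wr ws wp wt wq] : [/\ (e r w = false) * ((w == r) = false),
   (e s w = false) * ((w == s) = false), (e p w = false) * ((w == p) = false),
   (e t w = false) * ((w == t) = false) & (e q w = false) * ((w == q) = false)].
  by split; apply: wN; rewrite !inE eqxx ?orbT.
have adjE := (rs, rp, sp, rt, rq, tq, st, sq, pt, pq,
  etrans (e_sym s r) rs, etrans (e_sym p r) rp, etrans (e_sym p s) sp,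
  etrans (e_sym t r) rt, etrans (e_sym q r) rq, etrans (e_sym q t) tq,
  etrans (e_sym t s) st, etrans (e_sym q s) sq, etrans (e_sym t p) pt,
  etrans (e_sym q p) pq, e_irr).
move: cu; rewrite /= !inE !negb_or => /and5P[/and4P[nrs nrp nrt nrq] /and3P[nsp nst nsq]
  /andP[npt npq] ntq _].
have nE (i j : 'I_n) : i != j -> ((i == j) = false) * ((j == i) = false).
  by move=> ij; split; [|rewrite eq_sym]; exact: negbTE.
have neqE := (nE _ _ nrs, nE _ _ nrp, nE _ _ nrt, nE _ _ nrq, nE _ _ nsp, nE _ _ nst,
  nE _ _ nsq, nE _ _ npt, nE _ _ npq, nE _ _ ntq, eqxx).
have cW c : c \in [:: r; s; p; t; q; w] -> ('e_c <= supp R W)%MS.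
  by move=> cin; apply/unitv_supp/sW.
suff /fam3 : fam W [:: 'e_w; 'e_s + 'e_p + 'e_t + 'e_q - 'e_r; 'e_s - 'e_p; 'e_t - 'e_q] by [].
apply: fam_cone => //; first by apply: sW; rewrite !inE eqxx !orbT.
  move=> y; rewrite !inE => /or3P[]/eqP->; rewrite !formE // ?wr ?ws ?wp ?wt ?wq !mxE ?eqxx
    ?wr ?ws ?wp ?wt ?wq /=; split; lra.
split.
- by rewrite ?(addmx_sub, eqmx_opp) ?cW // !inE eqxx ?orbT.
- by rewrite !formE // !adjE /=; lra.
- by move=> y; rewrite !inE => /orP[]/eqP->; rewrite !formE // !adjE /=; lra.
- exists r; first by rewrite !mxE !neqE /=; apply/eqP; lra.
  by move=> y; rewrite !inE => /orP[]/eqP->; rewrite !mxE !neqE /=; lra.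
split.
- by rewrite ?(addmx_sub, eqmx_opp) ?cW // !inE eqxx ?orbT.
- by rewrite !formE // !adjE /=; lra.
- by move=> y; rewrite !inE => /eqP->; rewrite !formE // !adjE /=; lra.
- exists s; first by rewrite !mxE !neqE /=; apply/eqP; lra.
  by move=> y; rewrite !inE => /eqP->; rewrite !mxE !neqE /=; lra.
split => //.
- by rewrite ?(addmx_sub, eqmx_opp) ?cW // !inE eqxx ?orbT.
- by rewrite !formE // !adjE /=; lra.
- by exists t => //; rewrite !mxE !neqE /=; apply/eqP; lra.
Qed.
End Pentagon.

Local Open Scope nat_scope.

Section Link.
Variables (R : realFieldType) (n : nat) (e : rel 'I_n).
Hypotheses (e_sym : symmetric e) (e_irr : irreflexive e).
Local Notation adj := (adj R e).
Local Notation fam := (nonpos_family adj).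

Lemma rel_of_bitsE (T : eqType) (f : rel T) (h : nat -> T) : symmetric f -> irreflexive f ->
  {in iota 0 5 &, forall i j,
    rel_of_bits [seq f (h ij.1) (h ij.2) | ij <- pairs5] i j = f (h i) (h j)}.
Proof.
move=> f_sym f_irr i j; rewrite !mem_iota /= => i5 j5.
by move: i j i5 j5 => [|[|[|[|[|i]]]]] [|[|[|[|[|j]]]]] //= _ _; rewrite ?f_irr // f_sym.
Qed.

Variable W : {set 'I_n}.
Hypotheses (cW : #|W| = 6 + 3) (Wpos : npos_ge adj W 6).
Variable w : 'I_n.
Hypotheses (wW : w \in W) (dw : degree_in e W w = 3).

Let fam3 zs : fam W zs -> size zs <= 3.
Proof. exact: fam_size e_sym W cW Wpos zs. Qed.

Let M := enum (W :\: nbrs e w :\ w).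

Lemma size_M : size M = 5.
Proof.
have c1 : #|W :\: nbrs e w| = (9 - degree_in e W w)%N by rewrite cardsD cW /degree_in setIC.
have E : (9 - degree_in e W w = 1 + #|W :\: nbrs e w :\ w|)%N.
  by rewrite -c1 (cardsD1 w) in_setD mem_nbrs e_irr wW.
by rewrite -cardE; move: E; rewrite dw => -[].
Qed.

Lemma MP i : i \in M -> [/\ i \in W, i != w & ~~ e w i].
Proof. by rewrite mem_enum !inE => /and3P[-> -> ->]. Qed.

Local Notation h := (nth w M).

Lemma h_in i : i \in iota 0 5 -> h i \in M.
Proof. by rewrite mem_iota => i5; rewrite mem_nth ?size_M. Qed.

Lemma h_inj : {in iota 0 5 &, injective h}.
Proof.
move=> i j; rewrite !mem_iota => i5 j5 /eqP.
by rewrite nth_uniq ?size_M ?enum_uniq // => /eqP.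
Qed.

(** Each failure contradicts the bound 3 on families: three independent vertices and [w] make four,
    a K4 is handled by [no_clique4_cone], and a non-edge together with [w] is an independent triple,
    on which traces are distinct. *)
Lemma link_okP : link_ok (rel_of_bits [seq e (h ij.1) (h ij.2) | ij <- pairs5]).
Proof.
set g := rel_of_bits _.
have gE i j : i \in iota 0 5 -> j \in iota 0 5 -> g i j = e (h i) (h j).
  exact: rel_of_bitsE.
have hW i : i \in iota 0 5 -> [/\ h i \in W, h i != w & ~~ e w (h i)].
  by move/h_in/MP.
rewrite /link_ok.
have -> : all (fun '(i, j, k) => [|| g i j, g i k | g j k]) triples5.
  have t5 : all (fun '(i, j, k) => [&& i \in iota 0 5, j \in iota 0 5, k \in iota 0 5 &
     uniq [:: i; j; k]]) triples5 by [].
  apply/allP => -[[i j] k] /(allP t5) /and4P[i5 j5 k5 u]; rewrite !gE //.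
  apply: contraT; rewrite !negb_or => /and3P[ij ik jk].
  have [iW iw wi] := hW i i5; have [jW jw wj] := hW j j5; have [kW kw wk] := hW k k5.
  have ind : independent e [:: w; h i; h j; h k].
    move=> a b; rewrite !inE => /or4P[]/eqP-> /or4P[]/eqP->;
      by rewrite ?e_irr // e_sym.
  suff : fam W (map (unitv R) [:: w; h i; h j; h k]) by move/fam3.
  apply: fam_independent => //; last first.
    by move=> a; rewrite !inE => /or4P[]/eqP->.
  move: u; rewrite /= !inE !negb_or ![w == _]eq_sym iw jw kw !(inj_in_eq h_inj) //.
have -> : all (fun '(i, j, k, l) => ~~ [&& g i j, g i k, g i l, g j k, g j l & g k l]) quadruples5.
  have t5 : all (fun '(i, j, k, l) => all (fun x => x \in iota 0 5) [:: i; j; k; l] &&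
     uniq [:: i; j; k; l]) quadruples5 by [].
  apply/allP => -[[[i j] k] l] /(allP t5) /andP[/and5P[i5 j5 k5 l5 _] u]; rewrite !gE //.
  apply/negP => /and5P[ij ik il jk /andP[jl kl]].
  have W4 a : a \in [:: h i; h j; h k; h l] -> [/\ a \in W, a != w & ~~ e w a].
    by rewrite !inE => /or4P[]/eqP->; apply: hW.
  apply: (@no_clique4_cone R n e e_sym e_irr W cW Wpos w (h i) (h j) (h k) (h l)) => //.
  - by move: u; rewrite /= !inE !negb_or !(inj_in_eq h_inj).
  - by move=> a /W4[].
  - move=> a b; rewrite !inE => /or4P[]/eqP-> /or4P[]/eqP->; rewrite ?eqxx //;
      by rewrite ?ij ?ik ?il ?jk ?jl ?kl // e_sym ?ij ?ik ?il ?jk ?jl ?kl.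
  - by move=> a /W4[].
have t5 : all (fun '(i, j) => [&& i \in iota 0 5, j \in iota 0 5 & i != j]) pairs5 by [].
apply/allP => -[i j] /(allP t5)/and3P[i5 j5 ij]; rewrite gE //.
case: ifP => // eij; apply/allP => -[x y] /(allP t5)/and3P[x5 y5 xy].
case: ifP => // xij; case: ifP => // yij; rewrite !gE //; apply/negP => /andP[/eqP ixy /eqP jxy].
have [iW iw wi] := hW i i5; have [jW jw wj] := hW j j5.
have [xW xw wx] := hW x x5; have [yW yw wy] := hW y y5.
have ind : independent e [:: w; h i; h j].
  by apply: triple_independent => //; rewrite eij.
have u : uniq [:: w; h i; h j].
  by rewrite /= !inE !negb_or ![w == _]eq_sym iw jw !(inj_in_eq h_inj) // ij.
have sub : {subset [:: w; h i; h j] <= W} by move=> a; rewrite !inE => /or3P[]/eqP->.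
have inj := independent_traces_inj e_sym e_irr Wpos cW (erefl (size [:: w; h i; h j])) u sub ind.
have inD z : z \in iota 0 5 -> z \in [:: i; j] = false ->
    h z \in W :\: [set:: [:: w; h i; h j]].
  move=> z5; have [zW zw _] := hW z z5.
  rewrite !inE zW andbT (negPf zw) /= !(inj_in_eq h_inj) // => ->.
  by [].
have : h x = h y.
  apply: inj; rewrite ?inD // => a; rewrite !inE => /or3P[]/eqP-> //.
  by rewrite (negPf wx) (negPf wy).
by move/(h_inj x5 y5) => E; rewrite E eqxx in xy.
Qed.

(** If the non-neighbours of [w] form a pentagon, the three neighbours of [w] have pairwise negative
    [C5_form], and a copy of [edges1] or [edges2] appears; the bowtie is contradictory. *)
Lemma cubic_vertex_K5_minor : has_K5_minor e.
Proof.
have := allP link_classification _ (mem_bitstrings [seq e (h ij.1) (h ij.2) | ij <- pairs5]).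
cbv beta zeta; rewrite link_okP => /hasP[p]; rewrite mem_permutations => p5.
pose c i := h (nth 0 p i).
have sp : size p = 5 by rewrite (perm_size p5).
have pin i : i < 5 -> nth 0 p i \in iota 0 5.
  by move=> i5; rewrite -(perm_mem p5) mem_nth ?sp.
have gE (g : rel nat) : isomorphic5 g (rel_of_bits [seq e (h ij.1) (h ij.2) | ij <- pairs5]) p ->
    all (fun ij => e (c ij.1) (c ij.2) == g ij.1 ij.2) pairs5.
  have p5lt : all (fun ij => (ij.1 < 5) && (ij.2 < 5)) pairs5 by [].
  move=> iso; apply/allP => ij ijP; rewrite -(eqP (allP iso ij ijP)).
  by have /andP[? ?] := allP p5lt ij ijP; rewrite rel_of_bitsE // pin.
have cM i : i < 5 -> c i \in M by move=> i5; apply/h_in/pin.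
have c_uniq : uniq [seq c i | i <- iota 0 5].
  rewrite map_inj_in_uniq ?iota_uniq // => i j; rewrite !mem_iota => i5 j5.
  move/(h_inj (pin i i5) (pin j j5)) => /eqP; rewrite nth_uniq ?sp ?(perm_uniq p5) // => /eqP //.
have cP z : z \in [seq c i | i <- iota 0 5] -> [/\ z \in W, z != w & ~~ e w z].
  by case/mapP=> i; rewrite mem_iota => i5 ->; apply/MP/cM.
case/orP => /gE /=; rewrite !andbT.
  case/and5P=> /eqP c01 /eqP c02 /eqP c03 /eqP c04 /and5P[/eqP c12 /eqP c13 /eqP c14 /eqP c23].
  move=> /andP[/eqP c24 /eqP c34].
  pose N := enum (nbrs e w :&: W).
  have sN : size N = 3 by rewrite -cardE.
  pose x i := nth w N i.
  have xN i : i < 3 -> e w (x i) /\ x i \in W.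
    move=> i3; have : x i \in N by rewrite mem_nth ?sN.
    by rewrite mem_enum in_setI mem_nbrs => /andP[].
  have x_uniq i j : i < 3 -> j < 3 -> (x i == x j) = (i == j).
    by move=> i3 j3; rewrite nth_uniq ?sN ?enum_uniq.
  pose row i := [seq e (x i) (c k) | k <- iota 0 5].
  have rowP i j : i < 3 -> j < 3 -> i != j -> (C5_form (row i) (row j) < 0)%R.
    move=> i3 j3 ij; have [wi iW] := xN i i3; have [wj jW] := xN j j3.
    apply: (@pentagon_form_lt0 R n e e_sym e_irr W (c 0) (c 1) (c 2) (c 3) (c 4) w) => //.
    - move=> z; rewrite -[X in z \in X]/([seq c i | i <- iota 0 5] ++ [:: w; x i; x j]).
      by rewrite mem_cat => /orP[/cP[]//|]; rewrite !inE => /or3P[]/eqP->.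
    - by rewrite c01 c12 c23 c34 c04.
    - by rewrite c02 c03 c13 c14 c24.
    - by move=> z /cP[].
    - by rewrite x_uniq.
  have bits i : row i \in bitstrings 5 by apply: mem_bitstrings.
  have := allP (allP graph9_classification _ (bits 0)) _ (bits 1).
  cbv beta zeta; rewrite rowP // => /allP/(_ _ (bits 2)); rewrite !rowP //.
  set rows := [:: row 0; row 1; row 2] => /hasP[p' p'R].
  have all_perm : all (fun q => perm_eq q (iota 0 9)) relabellings by vm_compute.
  have p'9 := allP all_perm p' p'R.
  have sp' : size p' = 9 by rewrite (perm_size p'9).
  (* The labelling of [graph9]: 0 is [w], 1 to 3 are its neighbours, 4 to 8 the pentagon. *)
  pose v := nth w ([:: w; x 0; x 1; x 2] ++ [seq c i | i <- iota 0 5]).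
  have wx i : i < 3 -> w != x i.
    by move=> i3; apply: contraTneq (xN i i3).1 => <-; rewrite e_irr.
  have v_uniq : uniq ([:: w; x 0; x 1; x 2] ++ [seq c i | i <- iota 0 5]).
    rewrite cat_uniq c_uniq andbT; apply/andP; split.
      rewrite /= !inE !negb_or !x_uniq //= andbT.
      by rewrite !wx.
    apply/hasPn => z /cP[_ zw wz]; rewrite !inE (negPf zw) /= !negb_or.
    by apply/and3P; split; apply: contraNneq wz => ->; apply: (xN _ _).1.
  have gv i j : i < 9 -> j < 9 -> graph9 rows i j -> e (v i) (v j).
    have rowsE a b : 0 < a < 4 -> 3 < b < 9 ->
        nth false (nth [::] rows a.-1) (b - 4) = e (v a) (v b).
      move: a b => [|[|[|[|a]]]] // [|[|[|[|[|[|[|[|[|b]]]]]]]]] //.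
    have fixedE : all (fun ij => e (v ij.1) (v ij.2)) (spokes ++ pentagon_edges).
      by rewrite /= !(xN _ _).1 // c01 c12 c23 c34 c04.
    move=> i9 j9; rewrite /graph9 => /or3P[/orP[]/(allP fixedE) //| |].
    - by rewrite e_sym.
    - by case/and3P => i4 j3; rewrite rowsE // j3.
    - by case/and3P => j4 i3; rewrite rowsE ?i3 // e_sym.
  pose f (i : 'I_9) := v (nth 0 p' i).
  have p'lt (i : 'I_9) : nth 0 p' i < 9.
    by have := mem_nth 0 (_ : i < size p'); rewrite sp' (perm_mem p'9) mem_iota => /(_ (ltn_ord i)).
  have f_inj : injective f.
    move=> i j /eqP; rewrite nth_uniq //= ?p'lt // nth_uniq ?sp' ?(perm_uniq p'9) //.
    by move/eqP/val_inj.
  have emb E : contains E (graph9 rows) p' -> forall i j, rel9 E i j -> e (f i) (f j).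
    move=> /allP Ep i j /orP[]/Ep /= gij; first by apply: gv.
    by rewrite e_sym; apply: gv.
  case/orP => /emb H; first exact: has_K5_minor_inj f_inj H edges1_K5_minor.
  exact: has_K5_minor_inj f_inj H edges2_K5_minor.
case/and5P=> /eqP c01 /eqP c02 /eqP c03 /eqP c04 /and5P[/eqP c12 /eqP c13 /eqP c14 /eqP c23].
move=> /andP[/eqP c24 /eqP c34].
exfalso; apply: (@no_bowtie R n e e_sym e_irr W (c 0) (c 1) (c 2) (c 3) (c 4) w) => //.
- move=> z; rewrite -[X in z \in X]/([seq c i | i <- iota 0 5] ++ [:: w]).
  by rewrite mem_cat => /orP[/cP[]//|]; rewrite inE => /eqP->.
- by rewrite c01 c02 c12 c03 c04 c34.
- by rewrite c13 c14 c23 c24.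
- by move=> z /cP[].
Qed.
End Link.

(** * The bound for every number of negative eigenvalues *)

Section Bound.
Variables (R : realFieldType) (n : nat) (e : rel 'I_n).
Hypotheses (e_sym : symmetric e) (e_irr : irreflexive e).
Hypothesis noK5 : ~ has_K5_minor e.

Lemma bounded35 : bounded R e 3 5.
Proof.
move=> W noneg Wpos.
have [//|W' [cW' W'pos deg]] := critical_set e_sym e_irr (bounded23 e_sym e_irr) _ noneg Wpos.
have deg3 : {in W', forall v, 2 < degree_in e W' v} by move=> v /deg; lia.
have [w wW dw] := exists_cubic e_sym e_irr cW' W'pos deg3 noK5.
exact/noK5/(cubic_vertex_K5_minor e_sym e_irr cW' W'pos wW dw).
Qed.

(** From k = 3 on, the bounds 5, 10, 15, 21, ... grow by 5, 5, 6, ..., never by less than the 5 that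
    [bounded_step] asks for. *)
Lemma bounded_triangular k : exists2 m, 2 * m <= k * (k + 1) & bounded R e k m.
Proof.
have large j : bounded R e (j + 4) ((j + 4) * (j + 5))./2.
  elim: j => [|j IH]; first exact: (bounded_step e_sym e_irr noK5 _ bounded35).
  apply: bounded_step IH => //.
  have -> : (j.+1 + 4) * (j.+1 + 5) = (j + 4) * (j + 5) + 2 * (j + 5) by nia.
  by move: ((j + 4) * (j + 5)) => a; lia.
case: k => [|[|[|[|k]]]]; first by exists 0 => //; apply: bounded00.
- by exists 1 => //; apply: bounded11.
- by exists 3 => //; apply: bounded23.
- by exists 5 => //; apply: bounded35.
exists ((k + 4) * (k + 5))./2.
  have -> : k.+4 * (k.+4 + 1) = (k + 4) * (k + 5) by nia.
  by move: ((k + 4) * (k + 5)) => a; lia.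
by rewrite -addn4; apply: large.
Qed.
End Bound.

Lemma inertia_bound (R : rcfType) n (e : rel 'I_n) :
  symmetric e -> irreflexive e -> ~ has_K5_minor e ->
  2 * (\sum_(x <- rootsR (char_poly (adj R e)) | (0 < x)%R) mup x (char_poly (adj R e))) <=
  (\sum_(x <- rootsR (char_poly (adj R e)) | (x < 0)%R) mup x (char_poly (adj R e))) *
  (\sum_(x <- rootsR (char_poly (adj R e)) | (x < 0)%R) mup x (char_poly (adj R e)) + 1).
Proof.
move=> e_sym e_irr noK5; set neg := \sum_(x <- _ | (x < 0)%R) _.
have [m le_m bm] := bounded_triangular R e_sym e_irr noK5 neg.
apply: leq_trans le_m; rewrite leq_mul2l /= leqNgt; apply/negP => lt.
apply: (bm setT).
  by move/(nneg_ge_char_poly (adj_sym R e_sym)); rewrite ltnn.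
by apply: npos_ge_le lt _; apply: npos_ge_char_poly (adj_sym R e_sym).
Qed.

(** * From plane drawings to grid drawings *)

From mathcomp Require Import classical_sets functions topology normedtype.
Import numFieldNormedType.Exports.

Local Open Scope classical_set_scope.
Local Open Scope ring_scope.

Section Arcs.
Variable R : realType.
Implicit Types (A B : set (R * R)).

Lemma simple_arc_compact A a b : simple_arc A a b -> compact A.
Proof.
by case=> f [fc _ _ _ <-]; apply: continuous_compact => //; apply: segment_compact.
Qed.

(** Stated for all small [d], so that a filter argument yields one [d] for the finitely many pairs
    of arcs. *)
Lemma compact_separated A B : compact A -> compact B -> A `&` B = set0 ->
  \forall d \near (0 : R)^'+, forall p q, A p -> B q -> ~ ball p d q.
Proof.
move=> cA cB AB; have Bcl : closed B by apply: compact_closed => //; apply: norm_hausdorff.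
suff : \forall d \near (0 : R)^'+, A `<=` [set p | forall q, B q -> ~ ball p d q].
  by apply: filterS => d sub p q Ap; apply: sub.
move/compact_near_coveringP/near_covering_withinP: cA; apply.
move=> x Ax; have nBx : ~ B x by move=> Bx; have : (A `&` B) x by []; rewrite AB.
have /nbhs_ballP[r /= r0 rB] : nbhs x (~` B).
  by apply: open_nbhs_nbhs; split => //; apply: closed_openC.
(* One half of the radius is spent on moving [x] within [A], the other on [d]. *)
exists (ball x (r / 2), [set d | d < r / 2]) => /=.
  split; first by apply: nbhsx_ballx; lra.
  by apply: nbhs_right_lt; lra.
case=> y d /= [xy dr] Ay q Bq yq; apply: (rB q) => //.
rewrite (splitr r); apply: ball_triangle xy _.
by apply: le_ball yq; apply: ltW.
Qed.

(** The parametrization is uniformly continuous by compactness of the unit interval, so a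
    subdivision into [n] equal parts with 1/n below the modulus [h] works. *)
Lemma simple_arc_chain A a b (d : R) : simple_arc A a b -> 0 < d ->
  exists s : seq (R * R), [/\ path (fun p q => `[< ball p d q >]) a s, last a s = b &
    {in a :: s, forall p, A p}].
Proof.
case=> f [fc _ f0 f1 fA] d0.
have unif : \forall h \near (0 : R)^'+, [set` `[0, 1]] `<=` [set t : R | forall s : R,
    s \in `[0, 1] -> `|t - s| < h -> ball (f t) d (f s)].
  have /compact_near_coveringP/near_covering_withinP := @segment_compact R 0 1; apply.
  move=> x x01; have /subspace_continuousP/(_ x x01) fx := fc.
  have /nbhs_ballP[r /= r0 rf] : nbhs x [set y | y \in `[0, 1] -> ball (f x) (d / 2) (f y)].
    by apply: (fx (ball (f x) (d / 2))); apply: nbhsx_ballx; lra.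
  exists (ball x (r / 2), [set h | h < r / 2]) => /=.
    split; first by apply: nbhsx_ballx; lra.
    by apply: nbhs_right_lt; lra.
  case=> t h /= [xt hr] t01 s s01 ts.
  rewrite (splitr d); apply: ball_triangle (_ : ball _ _ (f x)) _.
    apply: ball_sym; apply: rf => //; apply: le_ball xt; lra.
  apply: rf => //; rewrite (splitr r); apply: ball_triangle xt _.
  by rewrite /ball /=; lra.
have [h [h0 fh]] : exists h : R, 0 < h /\ [set` `[0, 1]] `<=` [set t : R | forall s : R,
    s \in `[0, 1] -> `|t - s| < h -> ball (f t) d (f s)].
  have /filterI/(_ unif) := @nbhs_right_gt R 0 => /filter_ex[h [/= h0 fh]].
  by exists h.
pose n := (Num.truncn h^-1).+1.
have nh : n%:R^-1 < h.
  by rewrite invf_plt ?posrE ?ltr0n // truncnS_gt.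
pose g i := f (i%:R / n%:R).
have g01 i : (i <= n)%N -> (i%:R / n%:R : R) \in `[0, 1].
  move=> lin; rewrite in_itv /= divr_ge0 ?ler0n //=.
  by rewrite ler_pdivrMr ?ltr0n // mul1r ler_nat.
exists (map g (iota 1 n)).
have pathg m k : (m + k <= n)%N -> path (fun p q => `[< ball p d q >]) (g m) (map g (iota m.+1 k)).
  elim: k m => //= k IH m mk; rewrite IH ?andbT; last by lia.
  apply/asboolP; apply: fh; [exact/g01/(leq_trans _ mk)/leq_addr|by apply: g01; lia|].
  rewrite -mulrBl -opprB -natrB // subSnn normrM normrN1 mul1r ger0_norm ?invr_ge0 ?ler0n //.
have ag : a = g 0%N by rewrite /g mul0r f0.
split.
- by rewrite ag; apply: pathg.
- have lastn : last 0%N (iota 1 n) = n by rewrite -nth_last size_iota nth_iota.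
  by rewrite ag last_map lastn /g divff ?f1 // pnatr_eq0.
move=> p; rewrite ag inE => /orP[/eqP ->|/mapP[k]].
  by rewrite -fA; exists (0%:R / n%:R) => //; apply: g01.
by rewrite mem_iota => lin ->; rewrite -fA; exists (k%:R / n%:R) => //; apply: g01; lia.
Qed.
End Arcs.

Lemma floor_near (R : realType) (x y : R) : `|x - y| < 1 ->
  `|Num.floor x - Num.floor y| <= 1.
Proof.
move=> xy; have /andP[x1 x2] := floor_itv x; have /andP[y1 y2] := floor_itv y.
rewrite !intrD in x2 y2; move: xy; rewrite ltr_norml => /andP[xy1 xy2].
have two : (2%:~R : R) = 2 by [].
have : ((Num.floor x - Num.floor y)%:~R : R) < 2%:~R by rewrite intrB two; lra.
have : ((Num.floor y - Num.floor x)%:~R : R) < 2%:~R by rewrite intrB two; lra.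
by rewrite !ltr_int; lia.
Qed.

Lemma floor_far (R : realType) (x y : R) : `|Num.floor x - Num.floor y| <= 4 -> `|x - y| < 6.
Proof.
have /andP[x1 x2] := floor_itv x; have /andP[y1 y2] := floor_itv y.
move=> xy; have xy4 : Num.floor x <= Num.floor y + 4 by lia.
have yx4 : Num.floor y <= Num.floor x + 4 by lia.
move: x2 y2 xy4 yx4; rewrite -!(ler_int R) !intrD ltr_norml => ? ? ? ?.
have four : (4%:~R : R) = 4 by [].
by apply/andP; split; lra.
Qed.

Theorem planar_grid_drawing (R : realType) (V : finType) (e : rel V) :
  planar R e -> grid_drawing e.
Proof.
move=> [pt [arc [pt_inj _ arcP arc_ends arcs_meet]]].
pose indep (x y z t : V) := [&& x != z, x != t, y != z & y != t].
have sep x y z t : e x y -> e z t -> indep x y z t ->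
    \forall d \near (0 : R)^'+, forall p q, arc x y p -> arc z t q -> ~ ball p d q.
  move=> xy zt /and4P[xz xt yz yt]; apply: compact_separated.
  - exact: simple_arc_compact (arcP x y xy).
  - exact: simple_arc_compact (arcP z t zt).
  apply/seteqP; split => // p [pxy pzt].
  have [w _ wp] : range pt p.
    apply: (arcs_meet x y z t) => //.
      by move=> [zx]; move: xz; rewrite zx eqxx.
    by move=> [zy]; move: yz; rewrite zy eqxx.
  rewrite -wp in pxy pzt.
  (* A common point is a vertex, hence an end of both edges, contrary to independence. *)
  by case: (arc_ends _ _ _ xy pxy) (arc_ends _ _ _ zt pzt) => -> [] E;
    move: xz xt yz yt; rewrite E eqxx.
have [d [d0 dsep]] : exists d : R, 0 < d /\ forall q : V * V * (V * V),
    e q.1.1 q.1.2 -> e q.2.1 q.2.2 -> indep q.1.1 q.1.2 q.2.1 q.2.2 ->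
    forall p p', arc q.1.1 q.1.2 p -> arc q.2.1 q.2.2 p' -> ~ ball p d p'.
  have : \forall d \near (0 : R)^'+, forall q : V * V * (V * V),
    e q.1.1 q.1.2 -> e q.2.1 q.2.2 -> indep q.1.1 q.1.2 q.2.1 q.2.2 ->
    forall p p', arc q.1.1 q.1.2 p -> arc q.2.1 q.2.2 p' -> ~ ball p d p'.
    apply: filter_forall => -[[x y] [z t]] /=.
    have [xy|nxy] := boolP (e x y); last by apply: nearW.
    have [zt|nzt] := boolP (e z t); last by apply: nearW.
    have [ind|nind] := boolP (indep x y z t); last by apply: nearW.
    by apply: filterS (sep _ _ _ _ xy zt ind) => d H _ _ _.
  move=> /(filterI (@nbhs_right_gt R 0)) /filter_ex[d [/= d0 dsep]].
  by exists d.
(* After scaling by 6/d, consecutive chain points are less than 1 apart, so their floors differ by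
   at most 1; independent arcs are at least 6 apart in some coordinate, so there the floors differ
   by at least 5. *)
pose sc (p : R * R) : grid_point := (Num.floor (p.1 * (6 / d)), Num.floor (p.2 * (6 / d))).
have chain (xy : V * V) : exists s : seq (R * R), e xy.1 xy.2 ->
    [/\ path (fun p q => `[< ball p (d / 6) q >]) (pt xy.1) s, last (pt xy.1) s = pt xy.2 &
    {in pt xy.1 :: s, forall p, arc xy.1 xy.2 p}].
  case: (boolP (e xy.1 xy.2)) => [/arcP xyA|]; last by exists [::].
  have [|s sP] := simple_arc_chain (d := d / 6) xyA; first by lra.
  by exists s.
have [P PP] := boolp.choice chain.
exists (sc \o pt), (fun x y => map sc (P (x, y))); split.
  move=> x y xy; have [/= Ppath Plast _] := PP (x, y) xy.
  split; last by rewrite /= last_map Plast.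
  rewrite path_map; apply: sub_path Ppath => p q /asboolP[/= pq1 pq2].
  by apply/andP; split; apply: floor_near; rewrite -mulrBl normrM (gtr0_norm (_ : 0 < 6 / d))
     ?divr_gt0 // mulrA ltr_pdivrMr // mul1r; [move: pq1|move: pq2]; rewrite /ball /=; lra.
move=> x y z t xy zt ind p q; rewrite -![(sc \o pt) _]/(sc (pt _)) -!(map_cons sc).
move=> /mapP[p' pP ->] /mapP[q' qP ->].
have [/= _ _ /(_ _ pP) p'xy] := PP (x, y) xy; have [/= _ _ /(_ _ qP) q'zt] := PP (z, t) zt.
apply/negP => /andP[/floor_far n1 /floor_far n2].
apply: (dsep (x, y, (z, t)) xy zt ind _ _ p'xy q'zt).
split; [move: n1|move: n2]; rewrite -mulrBl normrM (gtr0_norm (_ : 0 < 6 / d))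
  ?divr_gt0 // mulrA ltr_pdivrMr // /ball /=; lra.
Qed.

Unset Implicit Arguments.

Theorem theorem4p9 (R : realType) (V : finType) (e : rel V)
    (simple_e : simple_graph e) (planar_e : planar R e) :
  (2 * npos R e <= nneg R e * (nneg R e + 1))%N.
Proof.
have [e_sym e_irr] := simple_e.
pose f (i j : 'I_#|V|) := e (enum_val i) (enum_val j).
have noK5 : ~ has_K5_minor f.
  move=> fK; have eK : has_K5_minor e by apply: has_K5_minor_inj enum_val_inj _ fK.
  exact: (grid_drawing_no_K5_minor e_sym (planar_grid_drawing planar_e) eK).
(* By conversion, [adj R f] is [adjacency R e]. *)
apply: (@inertia_bound R _ f) => //; first by move=> i j; apply: e_sym.
by move=> i; apply: e_irr.
Qed.
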